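(* Let $n\geqslant4$, let $(\overline M,\bar g)$ be a $1$-dimensional manifold with $\bar g_{11}=\varepsilon=\pm1$, let $(\widetilde N,\tilde g)$ be an $(n-1)$-dimensional Einstein semi-Riemannian manifold with scalar curvature $\tilde\kappa$, put $C_1=\frac{\tilde\kappa}{(n-1)(n-2)}$, let $F:\overline M\to\mathbb{R}^+$ be smooth, and let $\overline M\times_F\widetilde N$ be the warped product with metric $g$. Suppose that $$R\cdot C-C\cdot R=L\,Q(S,R)$$ holds on the set $U\subset\overline M\times_F\widetilde N$ of all points at which $Q(S,R)\neq0$, where $L$ is some function on $U$. Then on the set $\mathcal{U}=U\cap U_S\cap U_C$ we have either $$L=\frac{1}{n-2}\quad\text{and}\quad F(x^1)=(ax^1+b)^2,\quad a,b\in\mathbb{R},$$ or $$L=\frac{1}{n-1}\quad\text{and}\quad F(x^1)=\frac{c}{2}\Bigl(\exp\bigl(\pm\tfrac{b}{2}x^1\bigr)-\frac{2\varepsilon C_1}{b^2c}\exp\bigl(\mp\tfrac{b}{2}x^1\bigr)\Bigr)^2,\quad c>0,\ b\neq0,$$ $$\text{or}\quad L=\frac{1}{n-1}\quad\text{and}\quad F(x^1)=\frac{2\varepsilon C_1}{c}\bigl(1+\sin(cx^1+b)\bigr),\quad \frac{\varepsilon C_1}{c}>0,$$ where $b$ and $c$ are real constants.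
   Context: All manifolds are connected, paracompact and $C^\infty$. For a semi-Riemannian manifold $(M,g)$ of dimension $n$ with Levi-Civita connection $\nabla$ and a symmetric $(0,2)$-tensor $A$: $(X\wedge_AY)Z=A(Y,Z)X-A(X,Z)Y$; $\mathcal R(X,Y)Z=\nabla_X\nabla_YZ-\nabla_Y\nabla_XZ-\nabla_{[X,Y]}Z$; $S(X,Y)=\mathrm{tr}\{Z\mapsto\mathcal R(Z,X)Y\}$ is the Ricci tensor; the Ricci operator $\mathcal S$ is given by $g(\mathcal SX,Y)=S(X,Y)$; $\kappa=\mathrm{tr}\,\mathcal S$; $\mathcal C(X,Y)=\mathcal R(X,Y)-\frac{1}{n-2}\bigl(X\wedge_g\mathcal SY+\mathcal SX\wedge_gY-\frac{\kappa}{n-1}X\wedge_gY\bigr)$. The $(0,4)$-tensors are $R(X_1,X_2,X_3,X_4)=g(\mathcal R(X_1,X_2)X_3,X_4)$ and $C(X_1,X_2,X_3,X_4)=g(\mathcal C(X_1,X_2)X_3,X_4)$ (Weyl tensor). For $\mathcal B\in\{\mathcal R,\mathcal C\}$ with associated $(0,4)$-tensor $B\in\{R,C\}$ and a $(0,k)$-tensor $T$: $(B\cdot T)(X_1,\dots,X_k;X,Y)=-\sum_{i=1}^kT(X_1,\dots,\mathcal B(X,Y)X_i,\dots,X_k)$, and $Q(A,T)(X_1,\dots,X_k;X,Y)=-\sum_{i=1}^kT(X_1,\dots,(X\wedge_AY)X_i,\dots,X_k)$. A semi-Riemannian manifold is Einstein if its Ricci tensor equals (scalar curvature divided by dimension)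 times the metric at every point; thus the fiber satisfies $\widetilde S=\frac{\tilde\kappa}{n-1}\tilde g$. $U_S=\{x: S\neq\frac{\kappa}{n}g\text{ at }x\}$, $U_C=\{x: C\neq0\text{ at }x\}$. The warped product $\overline M\times_F\widetilde N$ is $\overline M\times\widetilde N$ with metric $g=\pi_1^*\bar g+(F\circ\pi_1)\pi_2^*\tilde g$, $\pi_1,\pi_2$ being the projections. $R,S,C,\kappa$ refer to $g$. Considerations are local, in product charts; $x^1$ is the coordinate on $\overline M$ with $\bar g_{11}=\varepsilon$, ranging over a suitable non-empty open interval of $\mathbb{R}$. *)

(* Defs.v *)
From HB Require Import structures.
From mathcomp Require Import all_boot all_order all_algebra.
From mathcomp Require Import all_classical all_reals all_analysis.

Set Implicit Arguments.
Unset Strict Implicit.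
Unset Printing Implicit Defensive.

Import Order.TTheory GRing.Theory Num.Theory.
Import numFieldNormedType.Exports.

Local Open Scope classical_set_scope.
Local Open Scope ring_scope.

Section Smooth.
Variables (R : realType) (V W : normedModType R).

(* f is C^k on O; meaningful for O open.  The values of f off O are irrelevant. *)
Fixpoint Ck (k : nat) (O : set V) (f : V -> W) : Prop :=
  (forall x, O x -> {for x, continuous f}) /\
  (if k is k'.+1 then
     (forall x, O x -> differentiable f x) /\ (forall v, Ck k' O ('D_v f))
   else True).

Definition smooth (O : set V) (f : V -> W) : Prop := forall k, Ck k O f.

End Smooth.

(* (0,k)-tensors on the tangent space 'rV[R]_d at a point of a chart. *)
Definition tensor (R : realType) (d k : nat) := ('I_k -> 'rV[R]_d) -> R.

Section TensorAlgebra.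
Variables (R : realType) (d : nat).
Notation vec := 'rV[R]_d.
Implicit Types (X Y Z : vec) (A : vec -> vec -> R).

Definition bil (G : 'M[R]_d) X Y : R := (X *m G *m Y^T) 0 0.

Definition trace_of (f : vec -> vec) : R := \tr (lin1_mx f).

(* (X /\_A Y) Z *)
Definition wedge A X Y Z : vec := A Y Z *: X - A X Z *: Y.

(* (B . T)(X_1, ..., X_k; X, Y) for an operator-valued B(X, Y). *)
Definition act k (B : vec -> vec -> vec -> vec) (T : tensor R d k)
    (Xs : 'I_k -> vec) X Y : R :=
  - \sum_(i < k) T (fun j => if j == i then B X Y (Xs i) else Xs j).

Definition Qtensor k A (T : tensor R d k) := act (wedge A) T.

(* B(X_1, X_2, X_3, X_4) = g(B(X_1, X_2) X_3, X_4) *)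
Definition lower4 (G : 'M[R]_d) (B : vec -> vec -> vec -> vec) : tensor R d 4 :=
  fun Xs => bil G (B (Xs 0) (Xs 1) (Xs 2)) (Xs 3).

End TensorAlgebra.

(* Curvature of a semi-Riemannian metric on an open subset of R^d, given by its
   Gram matrix g z in the coordinate frame at each point z. *)
Section Curvature.
Variables (R : realType) (d : nat) (g : 'rV[R]_d -> 'M[R]_d).
Notation vec := 'rV[R]_d.
Implicit Types (x X Y Z : vec) (i j k l : 'I_d).

Definition partial (f : vec -> R) i x : R := 'D_(delta_mx 0 i : vec) f x.

(* \Gamma^k_{ij} *)
Definition christoffel x i j k : R :=
  2^-1 * \sum_l invmx (g x) k l *
    (partial (fun z => g z j l) i x + partial (fun z => g z i l) j x
     - partial (fun z => g z i j) l x).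

Definition nabla (X Y : vec -> vec) (x : vec) : vec :=
  'D_(X x) Y x
  + \row_k \sum_i \sum_j X x 0 i * Y x 0 j * christoffel x i j k.

Definition lie_bracket (X Y : vec -> vec) (x : vec) : vec :=
  'D_(X x) Y x - 'D_(Y x) X x.

Definition curv_field (X Y Z : vec -> vec) : vec -> vec := fun x =>
  nabla X (nabla Y Z) x - nabla Y (nabla X Z) x - nabla (lie_bracket X Y) Z x.

(* The curvature operator is tensorial, so its value on tangent vectors at x is
   computed on their extensions with constant components. *)
Definition Riem x X Y Z : vec := curv_field (cst X) (cst Y) (cst Z) x.

Definition Ric x X Y : R := trace_of (fun Z => Riem x Z X Y).

(* The vector representing S(X, _) through the metric. *)
Definition RicOp x X : vec :=
  (\row_j Ric x X (delta_mx 0 j)) *m invmx (g x).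

Definition scal x : R := trace_of (RicOp x).

Definition Weyl x X Y Z : vec :=
  let w := wedge (bil (g x)) in
  Riem x X Y Z
  - (d%:R - 2)^-1 *:
      (w X (RicOp x Y) Z + w (RicOp x X) Y Z
       - (scal x / (d%:R - 1)) *: w X Y Z).

Definition R4 x : tensor R d 4 := lower4 (g x) (Riem x).
Definition C4 x : tensor R d 4 := lower4 (g x) (Weyl x).

Definition RC x := act (Riem x) (C4 x).
Definition CR x := act (Weyl x) (R4 x).
Definition QSR x := Qtensor (Ric x) (R4 x).

Definition Einstein_at x : Prop :=
  forall X Y, Ric x X Y = scal x / d%:R * bil (g x) X Y.

End Curvature.

(* Every open cover has a locally finite open refinement. *)
Definition paracompact (T : topologicalType) : Prop :=
  forall U : set (set T),
    U `<=` open -> \bigcup_(A in U) A = setT ->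
    exists V : set (set T),
      [/\ V `<=` open, \bigcup_(A in V) A = setT,
          (forall A, V A -> exists2 B, U B & A `<=` B) &
          forall x : T, exists2 W, nbhs x W &
            finite_set [set A | V A /\ A `&` W !=set0]].

Record chart (R : realType) (m : nat) (T : topologicalType) := Chart {
  cdom : set T;
  cmap : T -> 'rV[R]_m;
  cinv : 'rV[R]_m -> T }.

Section Charts.
Variables (R : realType) (m : nat) (T : topologicalType).
Implicit Types c : chart R m T.

Definition cimg c : set 'rV[R]_m := cmap c @` cdom c.

Definition is_chart c : Prop :=
  [/\ open (cdom c), open (cimg c),
      (forall y, cdom c y -> cinv c (cmap c y) = y),
      (forall y, cdom c y -> {for y, continuous (cmap c)}) &
      forall x, cimg c x -> {for x, continuous (cinv c)}].

Definition overlap c c' : set 'rV[R]_m := cmap c @` (cdom c `&` cdom c').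

Definition transition c c' : 'rV[R]_m -> 'rV[R]_m := cmap c' \o cinv c.

End Charts.

(* A connected, paracompact, Hausdorff, smooth m-manifold with a semi-Riemannian
   metric.  The atlas is presented as a family of charts [chart_at p] around the
   points p; [gram p] is the Gram matrix of the metric in the chart [chart_at p],
   relevant only on the image of that chart. *)
Record semiRiemannian (R : realType) (m : nat) := SemiRiemannian {
  pts :> topologicalType;
  chart_at : pts -> chart R m pts;
  gram : pts -> 'rV[R]_m -> 'M[R]_m;
  pts_hausdorff : hausdorff_space pts;
  pts_connected : connected [set: pts];
  pts_paracompact : paracompact pts;
  chart_atP : forall p, is_chart (chart_at p);
  chart_at_dom : forall p, cdom (chart_at p) p;
  transition_smooth : forall p q,
    smooth (overlap (chart_at p) (chart_at q))
           (transition (chart_at p) (chart_at q));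
  gram_smooth : forall p, smooth (cimg (chart_at p)) (gram p);
  gram_sym : forall p x, cimg (chart_at p) x -> (gram p x)^T = gram p x;
  gram_nondeg : forall p x, cimg (chart_at p) x -> gram p x \in unitmx;
  (* the local Gram matrices are those of one tensor field; mathcomp-analysis
     Jacobians act on row vectors from the right *)
  gram_compat : forall p q x, overlap (chart_at p) (chart_at q) x ->
    let tau := transition (chart_at p) (chart_at q) in
    gram p x = jacobian tau x *m gram q (tau x) *m (jacobian tau x)^T }.

Section Fiber.
Variables (R : realType) (m : nat) (N : semiRiemannian R m).

(* The tangent space at y is identified with 'rV[R]_m by the chart [chart_at y]. *)
Definition own_coord (y : N) : 'rV[R]_m := cmap (chart_at y) y.

Definition Einstein : Prop := forall y : N, Einstein_at (gram y) (own_coord y).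

Definition scalar_curvature (y : N) : R := scal (gram y) (own_coord y).

End Fiber.

(* The warped product I x_F N of an open interval I, with coordinate x^1 and
   metric component eps, with N.  Its tensors at (t, y) are computed in the product
   chart x^1 x [chart_at y]. *)
Section Warped.
Variables (R : realType) (m : nat) (eps : R) (I : set R) (F : R -> R).
Variable (N : semiRiemannian R m).
Implicit Types p : R * N.

Definition wmetric (y : N) (x : 'rV[R]_(1 + m)) : 'M[R]_(1 + m) :=
  block_mx (eps%:M : 'M[R]_1) 0
           0 (F (lsubmx x 0 0) *: gram y (rsubmx x)).

Definition wcoord p : 'rV[R]_(1 + m) := row_mx (const_mx p.1) (own_coord p.2).

Definition wRC p := RC (wmetric p.2) (wcoord p).
Definition wCR p := CR (wmetric p.2) (wcoord p).
Definition wQSR p := QSR (wmetric p.2) (wcoord p).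

Definition U_QSR : set (R * N) :=
  [set p | I p.1 /\ exists Xs X Y, wQSR p Xs X Y != 0].

Definition U_S : set (R * N) :=
  [set p | I p.1 /\ ~ Einstein_at (wmetric p.2) (wcoord p)].

Definition U_C : set (R * N) :=
  [set p | I p.1 /\ exists Xs, C4 (wmetric p.2) (wcoord p) Xs != 0].

End Warped.

Arguments U_QSR {R m} eps I F N.
Arguments U_S {R m} eps I F N.
Arguments U_C {R m} eps I F N.

(* Main.v *)
(* The curvature of the warped product is W + K, with W the Weyl tensor of the fibre
   and K the part determined by the sectional curvatures rho of the planes containing
   the base direction and sigma of the planes tangent to the fibre.  K is conformally
   flat, so W is also the Weyl tensor of the product, and R.C - C.R = K.C.

   Take a point with W <> 0 and rho <> sigma, that is, a point of U_C and U_S.  With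
   one argument and one rotation vector along the base, the hypothesis expresses
   rho W as L rho (m W + c (g /\ g)), where c is a nonzero multiple of sigma - rho and
   m = n - 1; since W is trace-free this forces rho = 0.  The same component gives
   rho = 0 where Q(S,R) = 0.  With all vectors tangent to the fibre, the hypothesis
   becomes sigma (1 - (m - 1) L) Q(g,W) = 0, and Q(g,W) <> 0 since a nonzero
   trace-free curvature tensor is not invariant under rotations; thus
   L = 1/(m - 1) = 1/(n - 2).

   Finally rho is proportional to (sqrt F)''.  Wherever rho = 0 <> sigma the function
   F sigma is locally constant, so rho = 0 <> sigma is an open and closed condition on
   the interval and sqrt F is affine on all of it.  Hence the first alternative always
   holds. *)

Require Import Defs.
From HB Require Import structures.
From mathcomp Require Import all_boot all_order all_algebra.
From mathcomp Require Import all_classical all_reals all_analysis.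
From mathcomp Require Import ring lra.

Set Implicit Arguments.
Unset Strict Implicit.
Unset Printing Implicit Defensive.

Import Order.TTheory GRing.Theory Num.Theory.
Import numFieldNormedType.Exports.

Local Open Scope classical_set_scope.
Local Open Scope ring_scope.

(** * Differentiation of matrix-valued maps *)

Section Calculus.
Variables (R : realType) (V : normedModType R).
Implicit Types (x v : V).

(** The first-order expansion of [f] at [x] is also one of [g], and by uniqueness of the
    differential its linear part is that of [g]. *)
Lemma near_eq_differentiable (W : normedModType R) (f g : V -> W) x :
  (\near x, f x = g x) -> differentiable f x -> differentiable g x.
Proof.
move=> fg /diff_locallyP[dfc df].
have dg : g \o shift x = cst (g x) + 'd f x +o_ 0 id.
  apply/eqaddoP => e e0.
  have /eqaddoP/(_ e e0) := df.
  have : \forall h \near (0 : V), f (h + x) = g (h + x).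
    by move: fg; rewrite (near_shift 0 x) subr0.
  apply: filterS2 => h /= fgh.
  by rewrite !fctE /= fgh (nbhs_singleton fg).
have dgE := diff_unique dfc dg.
by apply/diff_locallyP; rewrite dgE.
Qed.

Lemma differentiable_bigsum (J : Type) (s : seq J) (P : pred J)
    (f : J -> V -> R) x :
  (forall j, differentiable (f j) x) ->
  differentiable (fun z => \sum_(j <- s | P j) f j z) x.
Proof.
move=> df; elim: s => [|j s ih].
  under eq_fun do rewrite big_nil; exact: differentiable_cst.
under eq_fun do rewrite big_cons; case: (P j) => //.
exact: differentiableD.
Qed.

Lemma differentiable_bigprod (J : Type) (s : seq J) (P : pred J)
    (f : J -> V -> R) x :
  (forall j, differentiable (f j) x) ->
  differentiable (fun z => \prod_(j <- s | P j) f j z) x.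
Proof.
move=> df; elim: s => [|j s ih].
  under eq_fun do rewrite big_nil; exact: differentiable_cst.
under eq_fun do rewrite big_cons; case: (P j) => //.
exact: differentiableM.
Qed.

Lemma is_derive_bigsum (J : Type) (s : seq J) (P : pred J)
    (f : J -> V -> R) (df : J -> R) x v :
  (forall j, is_derive x v (f j) (df j)) ->
  is_derive x v (fun z => \sum_(j <- s | P j) f j z) (\sum_(j <- s | P j) df j).
Proof.
move=> fdf; elim: s => [|j s ih].
  under eq_fun do rewrite big_nil; rewrite big_nil; exact: is_derive_cst.
under eq_fun do rewrite big_cons; rewrite big_cons; case: (P j) => //.
exact: is_deriveD.
Qed.

(** Differentiability is taken entry by entry, so that products, determinants and inverses reduce to
    the scalar rules. *)
Definition mxdiff m n (M : V -> 'M[R]_(m, n)) x :=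
  forall i j, differentiable (fun z => M z i j) x.

Lemma differentiable_mxdiff m n (M : V -> 'M[R]_(m, n)) x :
  differentiable M x -> mxdiff M x.
Proof.
by move=> dM i j; exact: (differentiable_comp dM (differentiable_coord _ _ _)).
Qed.

Lemma mxdiff_derivable m n (M : V -> 'M[R]_(m, n)) x v :
  mxdiff M x -> derivable M x v.
Proof. by move=> dM; apply/derivable_mxP => i j; exact: diff_derivable. Qed.

Lemma mxdiff_deriveE m n (M : V -> 'M[R]_(m, n)) x v i j :
  mxdiff M x -> 'D_v M x i j = 'D_v (fun z => M z i j) x.
Proof. by move=> dM; rewrite derive_mx ?mxE //; exact: mxdiff_derivable. Qed.

Lemma differentiable_deriveD (W : normedModType R) (f : V -> W) x u v :
  differentiable f x -> 'D_(u + v) f x = 'D_u f x + 'D_v f x.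
Proof. by move=> df; rewrite !deriveE // linearD. Qed.

Lemma differentiable_deriveZ (W : normedModType R) (f : V -> W) x a v :
  differentiable f x -> 'D_(a *: v) f x = a *: 'D_v f x.
Proof. by move=> df; rewrite !deriveE // linearZ. Qed.

Lemma mxdiff_linear m n (M : V -> 'M[R]_(m, n)) x a u v :
  mxdiff M x -> 'D_(a *: u + v) M x = a *: 'D_u M x + 'D_v M x.
Proof.
move=> dM; apply/matrixP => i j; rewrite mxE mxE !mxdiff_deriveE //.
by rewrite differentiable_deriveD // differentiable_deriveZ.
Qed.

Lemma mxdiff_mulmx m n p (A : V -> 'M[R]_(m, n)) (B : V -> 'M[R]_(n, p)) x :
  mxdiff A x -> mxdiff B x -> mxdiff (fun z => A z *m B z) x.
Proof.
move=> dA dB i j; under eq_fun do rewrite mxE.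
by apply: differentiable_bigsum => k; exact: differentiableM.
Qed.

Lemma derive_mulmx m n p (A : V -> 'M[R]_(m, n)) (B : V -> 'M[R]_(n, p)) x v :
  mxdiff A x -> mxdiff B x ->
  'D_v (fun z => A z *m B z) x = 'D_v A x *m B x + A x *m 'D_v B x.
Proof.
move=> dA dB; apply/matrixP => i j.
rewrite mxdiff_deriveE; last exact: mxdiff_mulmx.
under eq_fun do rewrite mxE.
have dAB k : is_derive x v (fun z => A z i k * B z k j)
    (A x i k *: 'D_v (fun z => B z k j) x + B x k j *: 'D_v (fun z => A z i k) x).
  by apply: is_deriveM; apply: derivableP; exact: diff_derivable.
have /@derive_val -> := is_derive_bigsum (index_enum _) xpredT dAB.
rewrite !mxE -big_split /=; apply: eq_bigr => k _.
by rewrite !mxdiff_deriveE // addrC; congr (_ + _); rewrite mulrC.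
Qed.

Lemma mxdiff_cst m n (A : 'M[R]_(m, n)) x : mxdiff (fun=> A) x.
Proof. by move=> i j; exact: differentiable_cst. Qed.

Lemma mxdiff_tr m n (A : V -> 'M[R]_(m, n)) x :
  mxdiff A x -> mxdiff (fun z => (A z)^T) x.
Proof. by move=> dA i j; under eq_fun do rewrite mxE; exact: dA. Qed.

Lemma mxdiffD m n (A B : V -> 'M[R]_(m, n)) x :
  mxdiff A x -> mxdiff B x -> mxdiff (fun z => A z + B z) x.
Proof.
by move=> dA dB i j; under eq_fun do rewrite mxE; exact: differentiableD.
Qed.

Lemma differentiable_det n (A : V -> 'M[R]_n) x :
  mxdiff A x -> differentiable (fun z => \det (A z)) x.
Proof.
move=> dA; apply: differentiable_bigsum => s.
by apply: differentiableM => //; apply: differentiable_bigprod.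
Qed.

(** Cramer's rule writes each entry as a cofactor over the determinant. It holds at invertible
    matrices only, whence the condition on a neighbourhood of [x]. *)
Lemma mxdiff_invmx n (A : V -> 'M[R]_n) x :
  (\near x, A x \in unitmx) -> mxdiff A x -> mxdiff (fun z => invmx (A z)) x.
Proof.
move=> uA dA i j.
apply: (@near_eq_differentiable _
    (fun z => (\det (A z))^-1 * ((-1) ^+ (j + i) *
                \det (row' j (col' i (A z)))))).
  by apply: filterS uA => z uz; rewrite /invmx uz !mxE.
apply: differentiableM.
  apply: differentiableV; first exact: differentiable_det.
  by rewrite -unitfE -unitmxE; exact: nbhs_singleton uA.
apply: differentiableM => //; apply: differentiable_det => k l.
by under eq_fun do rewrite !mxE; exact: dA.
Qed.

(** The two sides have the same difference quotient, as a function of the increment. *)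
Lemma derive_comp_linear (U W : normedModType R) (L : V -> U) (f : U -> W) x v :
  (forall h, L (h *: v + x) = h *: L v + L x) ->
  'D_v (fun z => f (L z)) x = 'D_(L v) f (L x).
Proof.
move=> linL; rewrite /derive.
set a := (fun h : R => _); set b := (fun h : R => _).
by have -> : a = b by apply/funext => h; rewrite /a /b /= linL.
Qed.

End Calculus.

(** * Symmetry of second derivatives *)

Section Schwarz.
Variables (R : realType) (V : normedModType R).
Implicit Types (x y u v : V).

(** This turns a directional derivative into one of a function of a real variable, to which the mean
    value theorem applies. *)
Lemma is_derive_line (f : V -> R) y u (s d : R) :
  is_derive (s *: u + y) u f d -> is_derive s 1 (fun r => f (r *: u + y)) d.
Proof.
move=> [df dE].
have E : (fun h : R => h^-1 *: (((fun r => f (r *: u + y)) \o shift s) (h *: 1)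
           - f (s *: u + y)))
       = (fun h : R => h^-1 *: ((f \o shift (s *: u + y)) (h *: u)
           - f (s *: u + y))).
  apply/funext => h /=; congr (_ *: (f _ - _)).
  by rewrite [_%:A]mulr1 scalerDl addrA.
by split; [rewrite /derivable E|rewrite /derive E].
Qed.

Lemma MVT_line (f df : V -> R) y u (h : R) : 0 < h ->
  (forall s, 0 <= s <= h -> is_derive (s *: u + y) u f (df (s *: u + y))) ->
  exists2 s, 0 <= s <= h & f (h *: u + y) - f y = df (s *: u + y) * h.
Proof.
move=> h0 fdf.
have D s : s \in `[0, h]%R ->
    is_derive s 1 (fun r => f (r *: u + y)) (df (s *: u + y)).
  by rewrite in_itv /= => sh; apply: is_derive_line; exact: fdf.
have Doo s : s \in `]0, h[%R ->
    is_derive s 1 (fun r => f (r *: u + y)) (df (s *: u + y)).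
  by move=> sh; apply: D; exact: subset_itv_oo_cc.
have cf : {within `[0, h], continuous (fun r => f (r *: u + y))}.
  by apply: derivable_within_continuous => s /D[].
have [s sh E] := MVT h0 Doo cf.
exists s; first by move: (subset_itv_oo_cc sh); rewrite /= in_itv.
by move: E; rewrite subr0 scale0r add0r.
Qed.

(** The mean value theorem is applied twice: along [u] to the difference of [f] between [h *: v + y]
    and [y], then along [v] to the resulting difference of [fu]. *)
Lemma second_difference (f fu fuv : V -> R) (O : set V) x u v (h : R) : 0 < h ->
  (forall z, O z -> is_derive z u f (fu z)) ->
  (forall z, O z -> is_derive z v fu (fuv z)) ->
  (forall s t, 0 <= s <= h -> 0 <= t <= h -> O (s *: u + (t *: v + x))) ->
  exists s t, [/\ 0 <= s <= h, 0 <= t <= h &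
    f (h *: u + (h *: v + x)) - f (h *: u + x) - f (h *: v + x) + f x
    = fuv (s *: u + (t *: v + x)) * h * h].
Proof.
move=> h0 Du Dv hO.
have hh : 0 <= h <= h by rewrite lexx ltW.
have h00 : 0 <= (0 : R) <= h by rewrite lexx ltW.
pose g := (fun y => f (h *: v + y) - f y).
pose dg := (fun y => fu (h *: v + y) - fu y).
have shiftD y : is_derive (h *: v + y) u f (fu (h *: v + y)) ->
    is_derive y u (fun z => f (h *: v + z)) (fu (h *: v + y)).
  move=> [df dE].
  have E : (fun k : R => k^-1 *: (((fun z => f (h *: v + z)) \o shift y) (k *: u)
           - f (h *: v + y)))
       = (fun k : R => k^-1 *: ((f \o shift (h *: v + y)) (k *: u)
           - f (h *: v + y))).
    by apply/funext => k /=; rewrite addrCA.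
  by split; [rewrite /derivable E|rewrite /derive E].
have [s sh Es] : exists2 s, 0 <= s <= h &
    g (h *: u + x) - g x = dg (s *: u + x) * h.
  apply: MVT_line => // s sh; apply: is_deriveB.
    by apply: shiftD; apply: Du; rewrite addrCA; exact: hO.
  by apply: Du; rewrite -[x]add0r -[0](scale0r v); exact: hO.
have [t th Et] : exists2 t, 0 <= t <= h &
    fu (h *: v + (s *: u + x)) - fu (s *: u + x)
      = fuv (t *: v + (s *: u + x)) * h.
  by apply: MVT_line => // t th; apply: Dv; rewrite addrCA; exact: hO.
exists s, t; split => //.
rewrite [in RHS]addrCA -Et -/(dg _) -Es /g.
rewrite [h *: v + (h *: u + x)]addrCA; ring.
Qed.

(** The second difference of [f] over a small parallelogram at [x] is [h * h] times a value of [fuv]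
    and also [h * h] times a value of [fvu], both taken near [x]. If the two functions differed at
    [x], continuity would forbid this for small [h]. *)
Lemma schwarz (f fu fv fuv fvu : V -> R) (O : set V) x u v :
  open O -> O x ->
  (forall z, O z -> is_derive z u f (fu z)) ->
  (forall z, O z -> is_derive z v f (fv z)) ->
  (forall z, O z -> is_derive z v fu (fuv z)) ->
  (forall z, O z -> is_derive z u fv (fvu z)) ->
  {for x, continuous fuv} -> {for x, continuous fvu} ->
  fuv x = fvu x.
Proof.
move=> oO Ox Du Dv Duv Dvu cuv cvu.
apply/eqP/negPn/negP => neq.
pose e := `|fuv x - fvu x| / 2.
have e0 : 0 < e by rewrite divr_gt0 // normr_gt0 subr_eq0.
have /nbhs_ballP[r /= r0 rP] : \forall z \near x,
    [/\ O z, `|fuv x - fuv z| < e & `|fvu x - fvu z| < e].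
  have o : \forall z \near x, O z by exact: open_nbhs_nbhs.
  have a : \forall z \near x, `|fuv x - fuv z| < e.
    by move/cvgrPdist_lt : cuv => /(_ _ e0).
  have b : \forall z \near x, `|fvu x - fvu z| < e.
    by move/cvgrPdist_lt : cvu => /(_ _ e0).
  by near=> z; split; near: z.
(* With this [h] the parallelogram with sides [h *: u] and [h *: v] at [x] lies in the ball of
   radius [r]; the summand 1 keeps the denominator positive when [u] and [v] vanish. *)
pose h := r / (2 * (`|u| + `|v| + 1)).
have n0 : 0 < `|u| + `|v| + 1 by rewrite ltr_wpDl // addr_ge0.
have h0 : 0 < h by rewrite divr_gt0 // mulr_gt0.
have rB s t : 0 <= s <= h -> 0 <= t <= h -> ball x r (s *: u + (t *: v + x)).
  move=> /andP[s0 sh] /andP[t0 th]; rewrite -ball_normE /=.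
  rewrite addrA opprD addrCA subrr addr0 normrN.
  apply: (le_lt_trans (ler_normD _ _)).
  rewrite !normrZ !ger0_norm //.
  apply: (@le_lt_trans _ _ (h * `|u| + h * `|v|)).
    by apply: lerD; apply: ler_wpM2r.
  have -> : h * `|u| + h * `|v| = h * (`|u| + `|v| + 1) - h by ring.
  have -> : h * (`|u| + `|v| + 1) = r / 2.
    by rewrite /h invfM !mulrA mulfVK // gt_eqF.
  lra.
have [s [t [sh th E1]]] := second_difference h0 Du Duv
  (fun s t hs ht => (let: And3 a _ _ := rP _ (rB s t hs ht) in a)).
(* The second difference is symmetric in [u] and [v], so the same quantity is now expressed through
   [fvu]. *)
have [|t' [s' [t'h s'h E2]]] := @second_difference f fv fvu O x v u h h0 Dv Dvu.
  by move=> t' s' ht hs; rewrite addrCA; have [] := rP _ (rB s' t' hs ht).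
have E : fuv (s *: u + (t *: v + x)) = fvu (s' *: u + (t' *: v + x)).
  apply: (mulIf (lt0r_neq0 h0)); apply: (mulIf (lt0r_neq0 h0)).
  rewrite -E1 [in RHS]addrCA -E2 [h *: v + (h *: u + x)]addrCA; ring.
have [_ a _] := rP _ (rB s t sh th).
have [_ _ b] := rP _ (rB s' t' s'h t'h).
have : `|fuv x - fvu x| < e + e.
  have -> : fuv x - fvu x = (fuv x - fuv (s *: u + (t *: v + x)))
     - (fvu x - fvu (s' *: u + (t' *: v + x))) by rewrite E; ring.
  by apply: (le_lt_trans (ler_normB _ _)); exact: ltrD.
by rewrite /e -splitr ltxx.
Unshelve. all: by end_near. Qed.

End Schwarz.

(** * The Levi-Civita connection and its curvature *)

Section BilinearForm.
Variables (R : realType) (d : nat).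
Implicit Types (G : 'M[R]_d) (X Y Z : 'rV[R]_d).

Lemma bilDl G X Y Z : bil G (X + Y) Z = bil G X Z + bil G Y Z.
Proof. by rewrite /bil !mulmxDl mxE. Qed.

Lemma bilDr G X Y Z : bil G X (Y + Z) = bil G X Y + bil G X Z.
Proof. by rewrite /bil linearD mulmxDr mxE. Qed.

Lemma bilZl G a X Y : bil G (a *: X) Y = a * bil G X Y.
Proof. by rewrite /bil -!scalemxAl mxE. Qed.

Lemma bilZr G a X Y : bil G X (a *: Y) = a * bil G X Y.
Proof. by rewrite /bil linearZ -scalemxAr mxE. Qed.

Lemma bilNl G X Y : bil G (- X) Y = - bil G X Y.
Proof. by rewrite -scaleN1r bilZl mulN1r. Qed.

Lemma bilNr G X Y : bil G X (- Y) = - bil G X Y.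
Proof. by rewrite -scaleN1r bilZr mulN1r. Qed.

Lemma bil0l G X : bil G 0 X = 0.
Proof. by rewrite -(scale0r 0) bilZl mul0r. Qed.

Lemma bil0r G X : bil G X 0 = 0.
Proof. by rewrite -(scale0r 0) bilZr mul0r. Qed.

Definition bilE := (bilDl, bilDr, bilNl, bilNr, bilZl, bilZr, bil0l, bil0r).

Lemma bilC G X Y : G^T = G -> bil G X Y = bil G Y X.
Proof.
move=> sG; rewrite /bil.
have -> : Y *m G *m X^T = (X *m G *m Y^T)^T.
  by rewrite !trmx_mul trmxK sG mulmxA.
by rewrite [RHS]mxE.
Qed.

Lemma bil_rowE G X Y : bil G X Y = \sum_j (X *m G) 0 j * Y 0 j.
Proof. by rewrite /bil mxE; apply: eq_bigr => j _; rewrite [_^T _ _]mxE. Qed.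

Lemma bil_delta G X j : bil G X (delta_mx 0 j) = (X *m G) 0 j.
Proof. by rewrite /bil trmx_delta -colE mxE. Qed.

(** Nondegeneracy of the metric: identities between vectors are proved below by pairing both sides
    with an arbitrary vector. *)
Lemma bil_inj G X Y : G \in unitmx ->
  (forall Z, bil G X Z = bil G Y Z) -> X = Y.
Proof.
move=> uG XY; apply: (can_inj (mulmxK uG)).
by apply/rowP => j; rewrite -!bil_delta.
Qed.

End BilinearForm.

Section MatrixCalculus.
Variables (R : realType) (V : normedModType R).

Lemma derive_tr m n (A : V -> 'M[R]_(m, n)) x v : mxdiff A x ->
  'D_v (fun z => (A z)^T) x = ('D_v A x)^T.
Proof.
move=> dA; apply/matrixP => i j; rewrite mxE !mxdiff_deriveE //.
  by under eq_fun do rewrite mxE.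
exact: mxdiff_tr.
Qed.

Lemma derive_bil d (A : V -> 'M[R]_d) (u w : V -> 'rV[R]_d) x v :
  mxdiff A x -> mxdiff u x -> mxdiff w x ->
  'D_v (fun z => bil (A z) (u z) (w z)) x =
  bil ('D_v A x) (u x) (w x) + bil (A x) ('D_v u x) (w x)
  + bil (A x) (u x) ('D_v w x).
Proof.
move=> dA du dw; have duA := mxdiff_mulmx du dA; have dtw := mxdiff_tr dw.
rewrite /bil -(@mxdiff_deriveE _ _ _ _ (fun z => u z *m A z *m (w z)^T)); last first.
  exact: mxdiff_mulmx.
rewrite derive_mulmx // derive_mulmx // derive_tr // mulmxDl !mxE; ring.
Qed.

Lemma mxdiffB m n (A B : V -> 'M[R]_(m, n)) x :
  mxdiff A x -> mxdiff B x -> mxdiff (fun z => A z - B z) x.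
Proof.
move=> dA dB i j.
have -> : (fun z => (A z - B z) i j) = (fun z => A z i j) - (fun z => B z i j).
  by apply/funext => z; rewrite mxE [X in _ + X]mxE.
exact: differentiableB.
Qed.

Lemma mxdiff_row n (f : 'I_n -> V -> R) x :
  (forall j, differentiable (f j) x) -> mxdiff (fun z => \row_j f j z) x.
Proof. by move=> df i j; under eq_fun do rewrite mxE; exact: df. Qed.

End MatrixCalculus.

Lemma rowDB (R : realType) d (A B : 'rV[R]_d) (c : 'I_d -> R) l :
  (A + B - \row_l c l) 0 l = A 0 l + B 0 l - c l.
Proof. by rewrite !mxE. Qed.

Lemma sum2DB (R : realType) d (w a b c : 'I_d -> 'I_d -> R) :
  \sum_i \sum_j w i j * (a i j + b i j - c i j)
  = \sum_i \sum_j w i j * a i j + \sum_i \sum_j w i j * b i j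
    - \sum_i \sum_j w i j * c i j.
Proof.
rewrite -big_split -sumrB; apply: eq_bigr => i _ /=.
by rewrite -big_split -sumrB; apply: eq_bigr => j _; rewrite mulrBr mulrDr.
Qed.

(* These identities are stated on variables because deciding that two distinct
   derivatives differ unfolds their limits and does not terminate in practice. *)
Lemma add_sub_swap (R : realType) (a b c c' : R) : c = c' ->
  a + b - c = b + a - c'.
Proof. by move=> ->; rewrite [a + b]addrC. Qed.

Lemma half_sum (R : realType) (a b p p' s t : R) :
  2 * b = p + s - t -> 2 * a = p' + t - s -> p' = p -> p = b + a.
Proof. lra. Qed.

Lemma curv_linear (R : realType) (d : nat) (a : R) (p q r s t u v w : 'rV[R]_d) :
  a *: p + q + (a *: r + s) - (a *: t + u + (a *: v + w))
  = a *: (p + r - (t + v)) + (q + s - (u + w)).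
Proof. by apply/rowP => k; rewrite !mxE; ring. Qed.

Lemma curv_opp (R : realType) (d : nat) (a : R) (p q r s : 'rV[R]_d) :
  r = - p -> s = - q -> - (a *: p + q) = a *: r + s.
Proof. by move=> -> ->; rewrite scalerN opprD. Qed.

Lemma skew_cancel (R : realType) (u v a b c d e f a' c' d' f' : R) :
  u = a + b + c + (e + d + f) -> v = a' + e + c' + (b + d' + f') -> u = v ->
  c + a - (c' + a') = - (f + d - (f' + d')).
Proof. by move=> -> ->; lra. Qed.

Lemma curv_cyclic (R : realType) (d : nat) (p q r s t u : 'rV[R]_d) :
  p + q - (r + s) + (r + s - (t + u)) + (t + u - (p + q)) = 0.
Proof. by apply/rowP => k; rewrite !mxE; ring. Qed.

Section Connection.
Variables (R : realType) (d : nat) (g : 'rV[R]_d -> 'M[R]_d).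
Notation vec := 'rV[R]_d.
Implicit Types (x z U V W X Y Z : vec).

(** The covariant derivative of the field with constant components [V] along the one with constant
    components [U]. *)
Definition gamma x U V : vec :=
  \row_k \sum_i \sum_j U 0 i * V 0 j * christoffel g x i j k.

Lemma gamma_linearl x a U V W :
  gamma x (a *: U + V) W = a *: gamma x U W + gamma x V W.
Proof.
apply/rowP => k; rewrite !mxE mulr_sumr -big_split /=; apply: eq_bigr => i _.
rewrite mulr_sumr -big_split /=; apply: eq_bigr => j _; rewrite !mxE; ring.
Qed.

Lemma gamma_linearr x a U V W :
  gamma x U (a *: V + W) = a *: gamma x U V + gamma x U W.
Proof.
apply/rowP => k; rewrite !mxE mulr_sumr -big_split /=; apply: eq_bigr => i _.
rewrite mulr_sumr -big_split /=; apply: eq_bigr => j _; rewrite !mxE; ring.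
Qed.

Lemma gamma0l x V : gamma x 0 V = 0.
Proof.
by apply: (addIr (gamma x 0 V)); rewrite add0r -{1}(scale1r (gamma x 0 V))
  -gamma_linearl scaler0 addr0.
Qed.

Lemma gamma0r x V : gamma x V 0 = 0.
Proof.
by apply: (addIr (gamma x V 0)); rewrite add0r -{1}(scale1r (gamma x V 0))
  -gamma_linearr scaler0 addr0.
Qed.

Lemma nabla_cst X (Y : vec -> vec) x :
  nabla g (cst X) Y x = 'D_X Y x + gamma x X (Y x).
Proof. by []. Qed.

(** Fields with constant components commute, so the bracket term of the curvature drops out. *)
Lemma RiemE x X Y Z : Riem g x X Y Z =
  'D_X (fun z => gamma z Y Z) x + gamma x X (gamma x Y Z)
  - ('D_Y (fun z => gamma z X Z) x + gamma x Y (gamma x X Z)).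
Proof.
have ncst A B : nabla g (cst A) (cst B) = fun z => gamma z A B.
  by apply/funext => z; rewrite nabla_cst derive_cst add0r.
have lie0 A B : lie_bracket (cst A : vec -> vec) (cst B) = cst 0.
  by apply/funext => z; rewrite /lie_bracket !derive_cst subrr.
by rewrite /Riem /curv_field !ncst !nabla_cst lie0 ncst gamma0l subr0.
Qed.

Lemma Riem_skew x X Y Z : Riem g x X Y Z = - Riem g x Y X Z.
Proof. by rewrite !RiemE opprB. Qed.

Let dg_delta x U : mxdiff g x ->
  'D_U g x = \sum_i U 0 i *: 'D_(delta_mx 0 i) g x.
Proof.
move=> dg; apply/matrixP => i j; rewrite mxdiff_deriveE // summxE.
under eq_bigr do rewrite mxE mxdiff_deriveE // deriveE // -linearZ.
by rewrite deriveE // [in LHS](row_sum_delta U) linear_sum.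
Qed.

(** Twice the Christoffel symbols of the first kind contracted with [U] and [V], as a row vector; it
    is not the scalar curvature. *)
Definition kappa x U V : vec :=
  V *m 'D_U g x + U *m 'D_V g x
  - \row_l bil ('D_(delta_mx 0 l) g x) U V.

(** This replaces the coordinate sums by a matrix product, to which the rules for [mxdiff] apply.
    The transpose appears because [christoffel] contracts the second index of the inverse matrix. *)
Lemma gammaE x U V : mxdiff g x ->
  gamma x U V = 2^-1 *: (kappa x U V *m (invmx (g x))^T).
Proof.
move=> dg; apply/rowP => k.
rewrite [LHS]mxE [RHS]mxE [X in _ = 2^-1 * X]mxE.
have partE i j l : partial (fun z => g z i j) l x = 'D_(delta_mx 0 l) g x i j.
  by rewrite mxdiff_deriveE.
have E1 l : (V *m 'D_U g x) 0 l
    = \sum_i \sum_j U 0 i * V 0 j * partial (fun z => g z j l) i x.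
  rewrite dg_delta // mulmx_sumr summxE; apply: eq_bigr => i _.
  rewrite -scalemxAr 2!mxE mulr_sumr; apply: eq_bigr => j _.
  by rewrite partE mulrA.
have E2 l : (U *m 'D_V g x) 0 l
    = \sum_i \sum_j U 0 i * V 0 j * partial (fun z => g z i l) j x.
  rewrite dg_delta // mulmx_sumr summxE exchange_big; apply: eq_bigr => i _.
  rewrite -scalemxAr 2!mxE mulr_sumr; apply: eq_bigr => j _.
  by rewrite partE mulrCA mulrA.
have E3 l : bil ('D_(delta_mx 0 l) g x) U V
    = \sum_i \sum_j U 0 i * V 0 j * partial (fun z => g z i j) l x.
  rewrite bil_rowE exchange_big; apply: eq_bigr => j _.
  rewrite mxE mulr_suml; apply: eq_bigr => i _.
  by rewrite partE mulrAC.
have kE l : kappa x U V 0 l = \sum_i \sum_j U 0 i * V 0 j *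
    (partial (fun z => g z j l) i x + partial (fun z => g z i l) j x
     - partial (fun z => g z i j) l x).
  have -> : kappa x U V 0 l = (V *m 'D_U g x) 0 l + (U *m 'D_V g x) 0 l
      - bil ('D_(delta_mx 0 l) g x) U V by exact: rowDB.
  apply: etrans (esym (sum2DB (fun i j => U 0 i * V 0 j)
    (fun i j => partial (fun z => g z j l) i x)
    (fun i j => partial (fun z => g z i l) j x)
    (fun i j => partial (fun z => g z i j) l x))).
  by congr (_ + _ - _); [exact: E1|exact: E2|exact: E3].
under [X in _ = 2^-1 * X]eq_bigr => l _ do rewrite kE [(_^T) _ _]mxE.
rewrite mulr_sumr.
under [RHS]eq_bigr => l _.
  rewrite mulr_suml mulr_sumr.
  under eq_bigr => i _ do rewrite mulr_suml mulr_sumr.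
  over.
rewrite [RHS]exchange_big /=; apply: eq_bigr => i _.
rewrite [RHS]exchange_big /=; apply: eq_bigr => j _.
rewrite /christoffel mulrA mulr_sumr; apply: eq_bigr => l _; ring.
Qed.

(** The Koszul formula for fields with constant components, whose brackets vanish. By nondegeneracy
    it determines [gamma], and the properties of the connection are read off from it. *)
Lemma koszul x U V W : mxdiff g x -> (g x)^T = g x -> g x \in unitmx ->
  2 * bil (g x) (gamma x U V) W =
  bil ('D_U g x) V W + bil ('D_V g x) U W - bil ('D_W g x) U V.
Proof.
move=> dg gs gu; rewrite gammaE // bilZl mulrA divff // mul1r.
rewrite /bil trmx_inv gs mulmxKV // /kappa mulmxBl mulmxDl.
rewrite [LHS]mxE [X in X + _]mxE [X in _ + X]mxE; congr (_ + _ - _).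
rewrite [in RHS](dg_delta W dg) mulmx_sumr mulmx_suml summxE mxE.
apply: eq_bigr => l _; rewrite [(\row__ _) _ _]mxE [(_^T) _ _]mxE mulrC.
by rewrite -scalemxAr -scalemxAl [RHS]mxE.
Qed.

Variable O : set vec.
Hypotheses (O_open : open O) (g_smooth : smooth O g).
Hypothesis g_sym : forall x, O x -> (g x)^T = g x.
Hypothesis g_unit : forall x, O x -> g x \in unitmx.

Let nearO x : O x -> \forall z \near x, O z.
Proof. by move=> Ox; exact: open_nbhs_nbhs. Qed.

Let dgd x : O x -> differentiable g x.
Proof. by move=> Ox; have [_ [/(_ _ Ox)]] := g_smooth 1. Qed.

Let dg_md x : O x -> mxdiff g x.
Proof. by move=> /dgd; exact: differentiable_mxdiff. Qed.

Let ddg_md x U : O x -> mxdiff ('D_U g) x.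
Proof.
move=> Ox; have [_ [_ /(_ U)[_ [/(_ _ Ox) + _]]]] := g_smooth 2.
exact: differentiable_mxdiff.
Qed.

Let dg_tr x U : O x -> ('D_U g x)^T = 'D_U g x.
Proof.
move=> Ox; have dg := dg_md Ox.
apply/matrixP => i j; rewrite mxE !mxdiff_deriveE //.
apply: near_eq_derive; apply: filterS (nearO Ox) => z Oz.
by rewrite -[in RHS](g_sym Oz) mxE.
Qed.

Let dgC x U V W : O x -> bil ('D_U g x) V W = bil ('D_U g x) W V.
Proof. by move=> Ox; rewrite bilC // dg_tr. Qed.

Let gC x V W : O x -> bil (g x) V W = bil (g x) W V.
Proof. by move=> Ox; rewrite bilC // g_sym. Qed.

(** The connection is torsion-free: the right-hand side of the Koszul formula is symmetric in [U]
    and [V]. *)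
Lemma gammaC x U V : O x -> gamma x U V = gamma x V U.
Proof.
move=> Ox; apply: (bil_inj (g_unit Ox)) => W.
apply: (@mulfI _ 2) => //; have dg := dg_md Ox; rewrite !koszul ?g_sym ?g_unit //.
exact: (add_sub_swap _ _ (dgC W U V Ox)).
Qed.

(** The connection is metric: in the sum of the Koszul formulas for [V], [W] and for [W], [V] only
    the derivative along [U] survives. *)
Lemma derive_metric x U V W : O x ->
  bil ('D_U g x) V W = bil (g x) (gamma x U V) W + bil (g x) V (gamma x U W).
Proof.
move=> Ox; rewrite (gC V) //.
have K A B := koszul U A B (dg_md Ox) (g_sym Ox) (g_unit Ox).
exact: (half_sum (K V W) (K W V) (dgC U W V Ox)).
Qed.

Lemma mxdiff_gamma x U V : O x -> mxdiff (fun z => gamma z U V) x.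
Proof.
move=> Ox i j.
apply: (@near_eq_differentiable _ _ _
    (fun z => (2^-1 *: (kappa z U V *m (invmx (g z))^T)) i j)).
  by apply: filterS (nearO Ox) => z Oz; rewrite gammaE //; exact: dg_md.
under eq_fun do rewrite mxE.
apply: differentiableM => //.
apply: mxdiff_mulmx; last first.
  apply: mxdiff_tr; apply: mxdiff_invmx; last exact: dg_md.
  by apply: filterS (nearO Ox) => z; exact: g_unit.
apply: mxdiffB; first apply: mxdiffD.
- by apply: mxdiff_mulmx; [exact: mxdiff_cst|exact: ddg_md].
- by apply: mxdiff_mulmx; [exact: mxdiff_cst|exact: ddg_md].
- apply: mxdiff_row => l.
  apply: (mxdiff_mulmx _ (mxdiff_cst V^T x) 0 0).
  by apply: mxdiff_mulmx; [exact: mxdiff_cst|exact: ddg_md].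
Qed.

Lemma Riem_linear1 x a X Y Z W : O x ->
  Riem g x (a *: X + Y) Z W = a *: Riem g x X Z W + Riem g x Y Z W.
Proof.
move=> Ox; rewrite !RiemE mxdiff_linear; last exact: mxdiff_gamma.
have -> : (fun z => gamma z (a *: X + Y) W)
    = (a \*: (fun z => gamma z X W) + (fun z => gamma z Y W)).
  by apply/funext => z; rewrite gamma_linearl.
rewrite deriveD; [|apply: derivableZ|]; [|exact/mxdiff_derivable/mxdiff_gamma..].
rewrite deriveZ; last exact/mxdiff_derivable/mxdiff_gamma.
by rewrite !gamma_linearl gamma_linearr curv_linear.
Qed.

Lemma Riem_linear2 x a X Y Z W : O x ->
  Riem g x Z (a *: X + Y) W = a *: Riem g x Z X W + Riem g x Z Y W.
Proof.
move=> Ox; rewrite Riem_skew Riem_linear1 //.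
exact: curv_opp (Riem_skew _ _ _ _) (Riem_skew _ _ _ _).
Qed.

Lemma Riem_linear3 x a X Y Z W : O x ->
  Riem g x Z W (a *: X + Y) = a *: Riem g x Z W X + Riem g x Z W Y.
Proof.
move=> Ox.
have dE A B : 'D_A (fun z => gamma z B (a *: X + Y)) x
    = a *: 'D_A (fun z => gamma z B X) x + 'D_A (fun z => gamma z B Y) x.
  have -> : (fun z => gamma z B (a *: X + Y))
      = (a \*: (fun z => gamma z B X) + (fun z => gamma z B Y)).
    by apply/funext => z; rewrite gamma_linearr.
  rewrite deriveD; [|apply: derivableZ|]; [|exact/mxdiff_derivable/mxdiff_gamma..].
  by rewrite deriveZ //; exact/mxdiff_derivable/mxdiff_gamma.
by rewrite !RiemE !dE !gamma_linearr curv_linear.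
Qed.

(** By the symmetry of [gamma] the terms of the cyclic sum cancel in pairs. *)
Lemma bianchi x X Y Z : O x ->
  Riem g x X Y Z + Riem g x Y Z X + Riem g x Z X Y = 0.
Proof.
move=> Ox.
have dC A B C : 'D_A (fun z => gamma z B C) x = 'D_A (fun z => gamma z C B) x.
  by apply: near_eq_derive; apply: filterS (nearO Ox) => z; exact: gammaC.
rewrite (RiemE x X) (RiemE x Y) (RiemE x Z).
rewrite (dC X Z Y) (dC Y Z X) (dC Z Y X).
rewrite (gammaC Z Y Ox) (gammaC Z X Ox) (gammaC Y X Ox).
exact: curv_cyclic.
Qed.

Let ddgC x U V : O x -> 'D_U ('D_V g) x = 'D_V ('D_U g) x.
Proof.
move=> Ox; apply/matrixP => i j.
have C2 A B : forall z, O z -> {for z, continuous ('D_B ('D_A g))}.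
  by have [_ [_ /(_ A)[_ [_ /(_ B)[]]]]] := g_smooth 2.
apply: (@schwarz _ _ (fun z => g z i j) (fun z => 'D_V g z i j)
  (fun z => 'D_U g z i j) (fun z => 'D_U ('D_V g) z i j)
  (fun z => 'D_V ('D_U g) z i j) O x V U) => //.
- move=> z Oz; rewrite mxdiff_deriveE; last exact: dg_md.
  by apply: derivableP; apply: diff_derivable; exact: dg_md.
- move=> z Oz; rewrite mxdiff_deriveE; last exact: dg_md.
  by apply: derivableP; apply: diff_derivable; exact: dg_md.
- move=> z Oz; rewrite mxdiff_deriveE; last exact: ddg_md.
  by apply: derivableP; apply: diff_derivable; exact: ddg_md.
- move=> z Oz; rewrite mxdiff_deriveE; last exact: ddg_md.
  by apply: derivableP; apply: diff_derivable; exact: ddg_md.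
- apply: (@continuous_comp _ _ _ ('D_U ('D_V g)) (fun M : 'M[R]_d => M i j)).
    exact: C2.
  exact: coord_continuous.
- apply: (@continuous_comp _ _ _ ('D_V ('D_U g)) (fun M : 'M[R]_d => M i j)).
    exact: C2.
  exact: coord_continuous.
Qed.

(** Differentiating [derive_metric] once more expresses the second derivative of the metric along
    [B] and then [A] through [gamma]. Its symmetry in [A] and [B] is the asserted skew-symmetry. *)
Lemma Riem_skew34 x X Y Z W : O x ->
  bil (g x) (Riem g x X Y Z) W = - bil (g x) Z (Riem g x X Y W).
Proof.
move=> Ox.
have E A B : bil ('D_A ('D_B g) x) Z W
  = bil ('D_A g x) (gamma x B Z) W
  + bil (g x) ('D_A (fun z => gamma z B Z) x) W
  + (bil ('D_A g x) Z (gamma x B W)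
  + bil (g x) Z ('D_A (fun z => gamma z B W) x)).
  have dm1 := dg_md Ox; have dm2 U := @mxdiff_gamma x B U Ox.
  have := @derive_bil _ _ _ ('D_B g) (fun=> Z) (fun=> W) x A (ddg_md B Ox)
    (mxdiff_cst _ _) (mxdiff_cst _ _).
  rewrite (derive_cst Z) (derive_cst W) bil0l bil0r !addr0 => <-.
  rewrite (@near_eq_derive _ _ _ _ ((fun z => bil (g z) (gamma z B Z) W)
      + (fun z => bil (g z) Z (gamma z B W)))); last first.
    by apply: filterS (nearO Ox) => z Oz; rewrite derive_metric.
  have dbil (u w : vec -> vec) : mxdiff u x -> mxdiff w x ->
      derivable (fun z => bil (g z) (u z) (w z)) x A.
    move=> du dw; apply: diff_derivable.
    exact: (mxdiff_mulmx (mxdiff_mulmx du dm1) (mxdiff_tr dw) 0 0).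
  rewrite deriveD; [|apply: dbil => //; exact: mxdiff_cst..].
  rewrite (derive_bil _ dm1 (dm2 Z) (mxdiff_cst _ _)).
  rewrite (derive_bil _ dm1 (mxdiff_cst _ _) (dm2 W)).
  by rewrite !derive_cst bil0l bil0r !addr0.
have EX A B : bil ('D_A ('D_B g) x) Z W
  = bil (g x) (gamma x A (gamma x B Z)) W
  + bil (g x) (gamma x B Z) (gamma x A W)
  + bil (g x) ('D_A (fun z => gamma z B Z) x) W
  + (bil (g x) (gamma x A Z) (gamma x B W)
     + bil (g x) Z (gamma x A (gamma x B W))
  + bil (g x) Z ('D_A (fun z => gamma z B W) x)).
  rewrite E; congr (_ + _ + (_ + _)); exact: derive_metric.
rewrite (RiemE x X Y Z) (RiemE x X Y W) !bilE.
exact: (skew_cancel (EX X Y) (EX Y X)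
  (congr1 (fun M => bil M Z W) (ddgC X Y Ox))).
Qed.

End Connection.

(** * The curvature of a warped product *)

Section RowBlocks.
Variables (R : realType) (m : nat).
Implicit Types (a b c : R) (v w : 'rV[R]_m) (X Y : 'rV[R]_(1 + m)).

Definition hd X : R := lsubmx X 0 0.
Definition tl X : 'rV[R]_m := rsubmx X.
Definition wvec a v : 'rV[R]_(1 + m) := row_mx (const_mx a) v.

Lemma hd_wvec a v : hd (wvec a v) = a.
Proof. by rewrite /hd /wvec row_mxKl mxE. Qed.

Lemma tl_wvec a v : tl (wvec a v) = v.
Proof. by rewrite /tl /wvec row_mxKr. Qed.

Lemma wvecK X : wvec (hd X) (tl X) = X.
Proof.
rewrite /wvec -[RHS]hsubmxK; congr row_mx.
by apply/matrixP => i j; rewrite [LHS]mxE !ord1.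
Qed.

Lemma wvec_ind X (P : 'rV[R]_(1 + m) -> Prop) :
  (forall a v, P (wvec a v)) -> P X.
Proof. by move=> H; rewrite -(wvecK X). Qed.

Lemma wvecD a b v w : wvec a v + wvec b w = wvec (a + b) (v + w).
Proof.
by rewrite /wvec add_row_mx; congr row_mx; apply/matrixP => i j; rewrite !mxE.
Qed.

Lemma wvecZ a b v : a *: wvec b v = wvec (a * b) (a *: v).
Proof.
by rewrite /wvec scale_row_mx; congr row_mx; apply/matrixP => i j; rewrite !mxE.
Qed.

Lemma wvecN b v : - wvec b v = wvec (- b) (- v).
Proof. by rewrite -scaleN1r wvecZ mulN1r scaleN1r. Qed.

Lemma hd_linear a X Y : hd (a *: X + Y) = a * hd X + hd Y.
Proof. by rewrite /hd linearP !mxE. Qed.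

Lemma tl_linear a X Y : tl (a *: X + Y) = a *: tl X + tl Y.
Proof. by rewrite /tl linearP. Qed.

End RowBlocks.

(* The result type [R], instead of its normed module structure, keeps the inferred
   algebraic structures of expressions in derivatives syntactically equal. *)
Definition der (R : realType) (f : R -> R) (t : R) : R := 'D_1 f t.

Section WarpedConnection.
Variables (R : realType) (m : nat) (eps : R) (F : R -> R).
Variable g : 'rV[R]_m -> 'M[R]_m.
Hypothesis eps2 : eps * eps = 1.
Implicit Types (x z U V W X Y Z : 'rV[R]_(1 + m)).

(** This is [wmetric] up to conversion, with [g] in place of the Gram matrix in a fixed chart of the
    fibre. *)
Definition wmet x : 'M[R]_(1 + m) :=
  block_mx (eps%:M : 'M[R]_1) 0 0 (F (hd x) *: g (tl x)).

Lemma bil_wmet x X Y :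
  bil (wmet x) X Y = eps * hd X * hd Y + F (hd x) * bil (g (tl x)) (tl X) (tl Y).
Proof.
elim/wvec_ind: X => a v; elim/wvec_ind: Y => b w.
rewrite !hd_wvec !tl_wvec /wvec /bil /wmet mul_row_block !mulmx0 addr0 add0r.
rewrite tr_row_mx mul_row_col mxE; congr (_ + _).
  by rewrite mul_mx_scalar -scalemxAl [LHS]mxE [X in _ * X]mxE big_ord1 !mxE mulrA.
by rewrite -scalemxAr -scalemxAl mxE.
Qed.

Variables (I : set R) (O : set 'rV[R]_m).
Hypotheses (I_open : open I) (F_smooth : smooth I F).
Hypothesis F_gt0 : forall t, I t -> 0 < F t.
Hypotheses (O_open : open O) (g_smooth : smooth O g).
Hypothesis g_sym : forall y, O y -> (g y)^T = g y.
Hypothesis g_unit : forall y, O y -> g y \in unitmx.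

Definition wdom : set 'rV[R]_(1 + m) := [set x | I (hd x) /\ O (tl x)].

Notation F1 := (der F).
Notation F2 := (der (der F)).

Let dF t : I t -> differentiable F t.
Proof. by move=> It; have [_ [/(_ _ It)]] := F_smooth 1. Qed.

Let dF1 t : I t -> differentiable F1 t.
Proof. by move=> It; have [_ [_ /(_ 1)[_ [/(_ _ It)]]]] := F_smooth 2. Qed.

Lemma differentiable_hd x : differentiable (@hd R m) x.
Proof.
exact: (differentiable_comp (differentiable_lsubmx x) (differentiable_coord _ _ _)).
Qed.

Lemma differentiable_tl x : differentiable (@tl R m) x.
Proof. exact: differentiable_rsubmx. Qed.

Lemma wdom_open : open wdom.
Proof.
rewrite openE => x [Ix Ox]; rewrite /interior.
have h1 : \forall z \near x, I (hd z).
  have /differentiable_continuous := differentiable_hd x.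
  by apply; exact: open_nbhs_nbhs.
have h2 : \forall z \near x, O (tl z).
  have /differentiable_continuous := differentiable_tl x.
  by apply; exact: open_nbhs_nbhs.
by apply: filterS2 h1 h2.
Qed.

Lemma derive_hd (f : R -> R) x v :
  differentiable f (hd x) -> 'D_v (fun z => f (hd z)) x = hd v * der f (hd x).
Proof.
move=> df; rewrite -[RHS]/(hd v *: 'D_1 f (hd x)) -differentiable_deriveZ //.
rewrite -[_ *: 1]/(hd v * 1) mulr1.
exact: (@derive_comp_linear _ _ _ _ (fun z => hd z) f x v (fun h => hd_linear h v x)).
Qed.

Lemma derive_tl (W : normedModType R) (f : 'rV[R]_m -> W) x v :
  'D_v (fun z => f (tl z)) x = 'D_(tl v) f (tl x).
Proof.
exact: (@derive_comp_linear _ _ _ _ (fun z => tl z) f x v (fun h => tl_linear h v x)).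
Qed.

Lemma derive_mul_hd (c : R) (f : R -> R) (h : 'rV[R]_(1 + m) -> R) x U :
  differentiable f (hd x) -> differentiable h x ->
  'D_U (fun z => c * f (hd z) * h z) x
  = c * (hd U * der f (hd x) * h x + f (hd x) * 'D_U h x).
Proof.
move=> df dh.
have dfh : derivable (fun z => f (hd z)) x U.
  by apply: diff_derivable; exact: (differentiable_comp (differentiable_hd x) df).
have dh' := @diff_derivable _ _ _ _ x U dh.
have -> : (fun z => c * f (hd z) * h z) = c \*: ((fun z => f (hd z)) * h).
  by apply/funext => z; rewrite -[RHS]/(_ * (_ * _)) mulrA.
rewrite (deriveZ _ (derivableM dfh dh')) (deriveM dfh dh') (derive_hd _ df).
by rewrite -![_ *: _]/(_ * _) [h x * _]mulrC addrC.
Qed.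

Lemma wmet_sym x : wdom x -> (wmet x)^T = wmet x.
Proof.
move=> [_ Ox]; rewrite /wmet tr_block_mx tr_scalar_mx !trmx0 linearZ /=.
by rewrite g_sym.
Qed.

Lemma wmet_unit x : wdom x -> wmet x \in unitmx.
Proof.
move=> [Ix Ox]; rewrite unitmxE /wmet det_ublock det_scalar expr1 detZ.
rewrite !unitrM -unitmxE g_unit // andbT; apply/andP; split.
  rewrite unitfE; apply/eqP => e0; move/eqP: eps2.
  by rewrite e0 mul0r eq_sym oner_eq0.
by apply: unitrX; rewrite unitfE gt_eqF // F_gt0.
Qed.

Let mxdiff_g x : wdom x -> mxdiff (fun z => g (tl z)) x.
Proof.
move=> [_ Ox] i j.
have dg : differentiable g (tl x) by have [_ [/(_ _ Ox)]] := g_smooth 1.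
exact: (differentiable_comp (differentiable_tl x) (differentiable_mxdiff dg i j)).
Qed.

Let differentiable_Fhd x : wdom x -> differentiable (fun z => F (hd z)) x.
Proof.
by move=> [Ix _]; exact: (differentiable_comp (differentiable_hd x) (dF Ix)).
Qed.

Let differentiable_F1hd x : wdom x -> differentiable (fun z => F1 (hd z)) x.
Proof.
by move=> [Ix _]; exact: (differentiable_comp (differentiable_hd x) (dF1 Ix)).
Qed.

Lemma mxdiff_wmet x : wdom x -> mxdiff wmet x.
Proof.
move=> wx i j; rewrite /wmet.
case: (split_ordP i) => i' ->; case: (split_ordP j) => j' ->.
- by under eq_fun do rewrite block_mxEul; exact: differentiable_cst.
- by under eq_fun do rewrite block_mxEur; exact: differentiable_cst.
- by under eq_fun do rewrite block_mxEdl; exact: differentiable_cst.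
- under eq_fun do rewrite block_mxEdr mxE.
  by apply: differentiableM; [exact: differentiable_Fhd|exact: mxdiff_g].
Qed.

Let differentiable_bil_g x (v w : 'rV[R]_m) : wdom x ->
  differentiable (fun z => bil (g (tl z)) v w) x.
Proof.
move=> wx.
apply: (mxdiff_mulmx (mxdiff_mulmx _ (mxdiff_g wx)) _ 0 0); exact: mxdiff_cst.
Qed.

Let derive_bil_g x (v w : 'rV[R]_m) U : wdom x ->
  'D_U (fun z => bil (g (tl z)) v w) x = bil ('D_(tl U) g (tl x)) v w.
Proof.
move=> wx; rewrite (derive_bil _ (mxdiff_g wx)); [|exact: mxdiff_cst..].
by rewrite (derive_cst v) (derive_cst w) bil0l bil0r !addr0 derive_tl.
Qed.

Lemma derive_wmet x U V W : wdom x ->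
  bil ('D_U wmet x) V W =
  hd U * F1 (hd x) * bil (g (tl x)) (tl V) (tl W)
  + F (hd x) * bil ('D_(tl U) g (tl x)) (tl V) (tl W).
Proof.
move=> wx; have [Ix Ox] := wx.
have := @derive_bil _ _ _ wmet (fun=> V) (fun=> W) x U (mxdiff_wmet wx)
  (mxdiff_cst _ _) (mxdiff_cst _ _).
rewrite (derive_cst V) (derive_cst W) bil0l bil0r !addr0 => <-.
have -> : (fun z => bil (wmet z) V W) = cst (eps * hd V * hd W)
    + (fun z => 1 * F (hd z) * bil (g (tl z)) (tl V) (tl W)).
  by apply/funext => z; rewrite bil_wmet -[in LHS](mul1r (F _)).
have d2 := differentiable_bil_g (tl V) (tl W) wx.
have d3 : derivable (fun z => 1 * F (hd z) * bil (g (tl z)) (tl V) (tl W)) x U.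
  apply: diff_derivable; apply: differentiableM => //; apply: differentiableM => //.
  exact: differentiable_Fhd.
rewrite (deriveD (derivable_cst _ _ _) d3) derive_cst add0r.
rewrite (derive_mul_hd _ _ (dF Ix) d2) mul1r; congr (_ + _ * _).
exact: derive_bil_g.
Qed.

(** The logarithmic derivative of [sqrt F]. *)
Definition phi (t : R) : R := F1 t / (2 * F t).

Lemma eqDB (a a' b b' c c' r : R) : a = a' -> b = b' -> c = c' ->
  a' + b' - c' = r -> a + b - c = r.
Proof. by move=> -> -> ->. Qed.

Lemma koszul_warped (e u v w f f' guv guw gvw k1 k2 k3 b : R) : e * e = 1 ->
  f != 0 -> 2 * b = k1 + k2 - k3 ->
  2 * (e * (- (e / 2) * f' * guv) * w
       + f * (f' / (2 * f) * (u * gvw + v * guw) + b))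
  = u * f' * gvw + f * k1 + (v * f' * guw + f * k2) - (w * f' * guv + f * k3).
Proof.
move=> e2 f0 bE.
have -> : e * (- (e / 2) * f' * guv) * w = - (f' * guv * w) / 2 * (e * e) by ring.
rewrite e2 mulr1 mulrDr mulrDr mulrDr [2 * (f * b)]mulrCA bE.
field; exact: f0.
Qed.

(** The right-hand side satisfies the Koszul formula of the product metric, because [gamma g]
    satisfies that of the fibre; nondegeneracy concludes. *)
Lemma wgammaE x U V : wdom x ->
  gamma wmet x U V = wvec
    (- (eps / 2) * F1 (hd x) * bil (g (tl x)) (tl U) (tl V))
    (phi (hd x) *: (hd U *: tl V + hd V *: tl U) + gamma g (tl x) (tl U) (tl V)).
Proof.
move=> wx; have [Ix Ox] := wx.
have dg : mxdiff g (tl x).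
  by apply: differentiable_mxdiff; have [_ [/(_ _ Ox)]] := g_smooth 1.
apply: (bil_inj (wmet_unit wx)) => W; apply: (@mulfI _ 2) => //.
have E : bil (wmet x) (wvec (- (eps / 2) * F1 (hd x) * bil (g (tl x)) (tl U) (tl V))
    (phi (hd x) *: (hd U *: tl V + hd V *: tl U) + gamma g (tl x) (tl U) (tl V))) W
  = eps * (- (eps / 2) * F1 (hd x) * bil (g (tl x)) (tl U) (tl V)) * hd W
    + F (hd x) * (phi (hd x) * (hd U * bil (g (tl x)) (tl V) (tl W)
        + hd V * bil (g (tl x)) (tl U) (tl W))
      + bil (g (tl x)) (gamma g (tl x) (tl U) (tl V)) (tl W)).
  by rewrite bil_wmet hd_wvec tl_wvec bilDl bilZl bilDl !bilZl.
apply: etrans (congr1 ( *%R 2) (esym E)).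
apply: etrans (koszul U V W (mxdiff_wmet wx) (wmet_sym wx) (wmet_unit wx)) _.
apply: (eqDB (derive_wmet _ _ _ wx) (derive_wmet _ _ _ wx) (derive_wmet _ _ _ wx)).
symmetry; rewrite /phi; apply: koszul_warped => //; first by rewrite gt_eqF ?F_gt0.
exact: koszul dg (g_sym Ox) (g_unit Ox).
Qed.

(* 2 sqrt F (sqrt F)'' *)
Definition radial t : R := F2 t - F1 t ^+ 2 / (2 * F t).

Let differentiable_phi t : I t -> differentiable phi t.
Proof.
move=> It; apply: differentiableM; first exact: dF1.
apply: differentiableV; first by apply: differentiableM => //; exact: dF.
by rewrite mulf_neq0 // gt_eqF // F_gt0.
Qed.

Let derive_phi t : I t ->
  der phi t = F2 t / (2 * F t) - F1 t ^+ 2 / (2 * F t ^+ 2).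
Proof.
move=> It; have F0 : F t != 0 by rewrite gt_eqF // F_gt0.
have h1 : derivable F t 1 by exact/diff_derivable/dF.
have h2 : derivable F1 t 1 by exact/diff_derivable/dF1.
have h3 : derivable (cst 2 * F) t 1.
  exact: (derivableM (derivable_cst _ _ _) h1).
have h4 : (cst 2 * F) t != 0 by rewrite !fctE; apply: mulf_neq0.
have h5 : is_derive t 1 (fun s => ((cst 2 * F) s)^-1) (- (2 * F t) ^- 2 *: (2 *: 'D_1 F t)).
  split; first exact: derivableV.
  rewrite deriveV // (deriveM (derivable_cst _ _ _) h1) derive_cst scaler0 addr0.
  by [].
have := @is_deriveM _ _ F1 (fun s => ((cst 2 * F) s)^-1) t 1 (F2 t) _ (derivableP h2) h5.
move=> /@derive_val E; apply: etrans E _.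
rewrite -![_ *: _]/(_ * _) !fctE /= -/(der F t).
move: (F2 t) (F1 t) (F t) F0 => f2 f1 f f0; field; exact: f0.
Qed.

Lemma mxdiff_wvec (a : 'rV[R]_(1 + m) -> R) (v : 'rV[R]_(1 + m) -> 'rV[R]_m) x :
  differentiable a x -> mxdiff v x -> mxdiff (fun z => wvec (a z) (v z)) x.
Proof.
move=> da dv i j; rewrite /wvec.
case: (split_ordP j) => k ->.
  by under eq_fun do rewrite row_mxEl mxE.
by under eq_fun do rewrite row_mxEr; exact: dv.
Qed.

Lemma derive_wvec (a : 'rV[R]_(1 + m) -> R) (v : 'rV[R]_(1 + m) -> 'rV[R]_m) x U :
  differentiable a x -> mxdiff v x ->
  'D_U (fun z => wvec (a z) (v z)) x = wvec ('D_U a x) ('D_U v x).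
Proof.
move=> da dv; apply/rowP => j; rewrite mxdiff_deriveE; last exact: mxdiff_wvec.
rewrite /wvec; case: (split_ordP j) => k ->.
  by rewrite row_mxEl mxE; under eq_fun do rewrite row_mxEl mxE.
rewrite row_mxEr mxdiff_deriveE //.
by under eq_fun do rewrite row_mxEr.
Qed.

Lemma mxdiff_scalel (a : 'rV[R]_(1 + m) -> R) (w : 'rV[R]_m) x :
  differentiable a x -> mxdiff (fun z => a z *: w) x.
Proof.
by move=> da i j; under eq_fun do rewrite mxE; exact: differentiableM.
Qed.

Lemma derive_scaleD (a : 'rV[R]_(1 + m) -> R) (w : 'rV[R]_m)
    (B : 'rV[R]_(1 + m) -> 'rV[R]_m) x U :
  differentiable a x -> mxdiff B x ->
  'D_U (fun z => a z *: w + B z) x = 'D_U a x *: w + 'D_U B x.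
Proof.
move=> da dB; have dw := mxdiff_scalel w da.
rewrite deriveD; [|exact: mxdiff_derivable..].
congr (_ + _); apply/rowP => j; rewrite mxdiff_deriveE // mxE.
under eq_fun do rewrite mxE.
rewrite -[fun _ => _]/(a * cst (w 0 j)) deriveM //; last exact: diff_derivable.
by rewrite derive_cst scaler0 add0r -[_ *: _]/(_ * _) mulrC.
Qed.

Let mxdiff_gamma_tl x (v w : 'rV[R]_m) : wdom x ->
  mxdiff (fun z => gamma g (tl z) v w) x.
Proof.
move=> [_ Ox] i j.
have dg := mxdiff_gamma O_open g_smooth g_unit v w Ox.
exact: (differentiable_comp (differentiable_tl x) (dg i j)).
Qed.

Let derive_wgamma x U V W : wdom x ->
  'D_U (fun z => gamma wmet z V W) x = wvec
    (- (eps / 2) * (hd U * F2 (hd x) * bil (g (tl x)) (tl V) (tl W)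
      + F1 (hd x) * bil ('D_(tl U) g (tl x)) (tl V) (tl W)))
    ((hd U * (F2 (hd x) / (2 * F (hd x)) - F1 (hd x) ^+ 2 / (2 * F (hd x) ^+ 2)))
       *: (hd V *: tl W + hd W *: tl V)
     + 'D_(tl U) (fun y => gamma g y (tl V) (tl W)) (tl x)).
Proof.
move=> wx; have [Ix Ox] := wx.
have ow : \forall z \near x, wdom z.
  by apply: open_nbhs_nbhs; split => //; exact: wdom_open.
rewrite (@near_eq_derive _ _ _ _ _ x U (filterS (fun z => @wgammaE z V W) ow)).
have d1 := differentiable_F1hd wx.
have d2 := differentiable_bil_g (tl V) (tl W) wx.
have d3 : differentiable (fun z => phi (hd z)) x.
  exact: (differentiable_comp (differentiable_hd x) (differentiable_phi Ix)).
have d4 := mxdiff_gamma_tl (tl V) (tl W) wx.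
have d12 : differentiable (fun z => - (eps / 2) * F1 (hd z)
    * bil (g (tl z)) (tl V) (tl W)) x.
  by apply: differentiableM => //; exact: differentiableM.
rewrite derive_wvec //; last by apply: mxdiffD => //; exact: mxdiff_scalel.
congr wvec.
  rewrite (derive_mul_hd _ _ (dF1 Ix) d2); congr (_ * (_ + _ * _)).
  exact: derive_bil_g.
apply: etrans (derive_scaleD _ _ d3 d4) _.
apply: (congr2 +%R _ (derive_tl (fun y => gamma g y (tl V) (tl W)) x U)).
apply: (congr1 (fun c => c *: _)).
apply: etrans (derive_hd U (differentiable_phi Ix)) _.
apply: (congr1 ( *%R (hd U))); exact: derive_phi.
Qed.

Let wgamma2 x X Y Z : wdom x -> let G := bil (g (tl x)) in
  let Ga := gamma g (tl x) in
  gamma wmet x X (gamma wmet x Y Z) = wvec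
    (- (eps / 2) * F1 (hd x) *
       (phi (hd x) * (hd Y * G (tl X) (tl Z) + hd Z * G (tl X) (tl Y))
        + G (tl X) (Ga (tl Y) (tl Z))))
    (phi (hd x) *: (hd X *: (phi (hd x) *: (hd Y *: tl Z + hd Z *: tl Y)
                             + Ga (tl Y) (tl Z))
                    + (- (eps / 2) * F1 (hd x) * G (tl Y) (tl Z)) *: tl X)
     + (phi (hd x) *: (hd Y *: Ga (tl X) (tl Z) + hd Z *: Ga (tl X) (tl Y))
        + Ga (tl X) (Ga (tl Y) (tl Z)))).
Proof.
move=> wx G Ga.
have gaZ (a : R) (v w : 'rV[R]_m) :
    gamma g (tl x) v (a *: w) = a *: gamma g (tl x) v w.
  by rewrite -[a *: w]addr0 gamma_linearr gamma0r addr0.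
have E := @wgammaE x Y Z wx.
apply: etrans (congr1 (gamma wmet x X) E) _.
apply: etrans (wgammaE _ _ wx) _; rewrite hd_wvec tl_wvec.
apply: congr2; first by rewrite bilDr bilZr bilDr !bilZr.
by rewrite gamma_linearr gamma_linearr gaZ.
Qed.

(** The base component of the curvature. The second hypothesis comes from metric compatibility in
    the fibre; it cancels the derivatives of the fibre metric against the connection terms. *)
Lemma curv_fst (e f1 f2 x0 y0 z0 gXY gYX gXZ gYZ gXc gYc dX dY ph q : R) :
  gYX = gXY -> dX - dY = gYc - gXc -> ph * f1 = q ->
  - (e / 2) * (x0 * f2 * gYZ + f1 * dX)
    + - (e / 2) * f1 * (ph * (y0 * gXZ + z0 * gXY) + gXc)
  - (- (e / 2) * (y0 * f2 * gXZ + f1 * dY)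
    + - (e / 2) * f1 * (ph * (x0 * gYZ + z0 * gYX) + gYc))
  = - (e / 2) * (f2 - q) * (x0 * gYZ - y0 * gXZ).
Proof.
move=> -> /eqP; rewrite subr_eq => /eqP -> <-; ring.
Qed.

(** The fibre component of the curvature. In the application [b] is [(sqrt F)'' / sqrt F], obtained
    as [phi' + phi ^+ 2], and [E] is [eps] times the square of [(sqrt F)']. *)
Lemma curv_snd (b c E ph x0 y0 z0 gXZ gYZ f1 dph : R)
    (X Y Z YZ XZ XY YX DX DY XYZ YXZ : 'rV[R]_m) :
  YX = XY -> dph + ph ^+ 2 = b -> c * (ph * f1) = E ->
  (x0 * dph) *: (y0 *: Z + z0 *: Y) + DX
    + (ph *: (x0 *: (ph *: (y0 *: Z + z0 *: Y) + YZ) + (- c * f1 * gYZ) *: X)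
       + (ph *: (y0 *: XZ + z0 *: XY) + XYZ))
  - ((y0 * dph) *: (x0 *: Z + z0 *: X) + DY
    + (ph *: (y0 *: (ph *: (x0 *: Z + z0 *: X) + XZ) + (- c * f1 * gXZ) *: Y)
       + (ph *: (x0 *: YZ + z0 *: YX) + YXZ)))
  = (DX + XYZ - (DY + YXZ)) + (b * z0) *: (x0 *: Y - y0 *: X)
    - E *: (gYZ *: X - gXZ *: Y).
Proof.
move=> -> <- <-; apply/rowP => k; rewrite !mxE; ring.
Qed.

Lemma sub_cancel (a a' b c : R) : a' = a -> a + b - (a' + c) = b - c.
Proof. by move=> ->; ring. Qed.

Lemma wvec_curv (a b c d : R) (t u v w : 'rV[R]_m) P1 P2 P3 P4 :
  P1 = wvec a t -> P2 = wvec b u -> P3 = wvec c v -> P4 = wvec d w ->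
  P1 + P2 - (P3 + P4) = wvec (a + b - (c + d)) (t + u - (v + w)).
Proof. by move=> -> -> -> ->; rewrite !wvecD wvecN wvecD. Qed.

Lemma Riem_warped x X Y Z : wdom x ->
  let G := bil (g (tl x)) in
  let P := radial (hd x) in
  Riem wmet x X Y Z = wvec
    (- (eps / 2) * P * (hd X * G (tl Y) (tl Z) - hd Y * G (tl X) (tl Z)))
    (Riem g (tl x) (tl X) (tl Y) (tl Z)
     + (P / (2 * F (hd x)) * hd Z) *: (hd X *: tl Y - hd Y *: tl X)
     - (eps * F1 (hd x) ^+ 2 / (4 * F (hd x))) *:
         (G (tl Y) (tl Z) *: tl X - G (tl X) (tl Z) *: tl Y)).
Proof.
move=> wx G P; have [Ix Ox] := wx.
have F0 : F (hd x) != 0 by rewrite gt_eqF // F_gt0.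
have gS (v w : 'rV[R]_m) : G v w = G w v by rewrite /G bilC // g_sym.
have gaC (v w : 'rV[R]_m) : gamma g (tl x) v w = gamma g (tl x) w v.
  exact: (gammaC O_open g_smooth g_sym g_unit v w Ox).
have dm (u v w : 'rV[R]_m) := derive_metric O_open g_smooth g_sym g_unit u v w Ox.
apply: etrans (RiemE wmet x X Y Z) _.
apply: etrans (wvec_curv (derive_wgamma _ _ _ wx) (wgamma2 _ _ _ wx)
  (derive_wgamma _ _ _ wx) (wgamma2 _ _ _ wx)) _.
apply: congr2.
  apply: (@curv_fst _ _ _ _ _ _ _ _ _ _ _ _ _ _ _ (F1 (hd x) ^+ 2 / (2 * F (hd x)))).
  - exact: gS.
  - apply: etrans (congr2 (fun a b => a - b) (dm _ _ _) (dm _ _ _)) _.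
    by apply: sub_cancel; exact: (congr1 (fun v => G v (tl Z)) (gaC _ _)).
  - by rewrite /phi expr2 mulrAC.
apply: etrans _ (congr2 (fun a b => a + _ - b) (esym (RiemE g _ _ _ _)) erefl).
apply: curv_snd; first exact: gaC.
- rewrite /P /radial /phi.
  move: (F1 (hd x)) (F2 (hd x)) (F (hd x)) F0 => f1 f2 f f0; field; exact: f0.
- rewrite /phi.
  move: (F1 (hd x)) (F (hd x)) F0 => f1 f f0; field; exact: f0.
Qed.

End WarpedConnection.

(** * Traces and the action of operators on tensors *)

Lemma trace_wvec (R : realType) (m : nat) (f : 'rV[R]_(1 + m) -> 'rV[R]_(1 + m)) :
  trace_of f = hd (f (wvec 1 0))
             + \sum_(i < m) tl (f (wvec 0 (delta_mx 0 i))) 0 i.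
Proof.
rewrite /trace_of /mxtrace big_split_ord big_ord1; congr (_ + _).
  rewrite mxE /hd mxE; congr (f _ _ _).
  apply/rowP => j; rewrite /wvec; case: (split_ordP j) => k ->.
    by rewrite row_mxEl !mxE (ord1 k) eqxx.
  by rewrite row_mxEr !mxE; case: eqP => // /eqP; rewrite eq_rlshift.
apply: eq_bigr => i _; rewrite mxE /tl mxE; congr (f _ _ _).
apply/rowP => j; rewrite /wvec; case: (split_ordP j) => k ->.
  by rewrite row_mxEl !mxE; case: eqP => // /eqP; rewrite eq_lrshift.
by rewrite row_mxEr !mxE eq_rshift.
Qed.

Lemma bil_sum (R : realType) d (G : 'M[R]_d) v a :
  bil G v a = \sum_i bil G (delta_mx 0 i) a * v 0 i.
Proof.
rewrite /bil [in LHS](row_sum_delta v) !mulmx_suml summxE; apply: eq_bigr => i _.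
by rewrite -!scalemxAl mxE mulrC.
Qed.

Lemma sum_delta_diag (R : realType) d :
  \sum_(i < d) (delta_mx 0 i : 'rV[R]_d) 0 i = d%:R.
Proof.
by under eq_bigr do rewrite mxE !eqxx; rewrite sumr_const card_ord.
Qed.

Lemma RicOp_unique (R : realType) d (h : 'rV[R]_d -> 'M[R]_d) x X V :
  h x \in unitmx -> (forall W, Ric h x X W = bil (h x) V W) -> RicOp h x X = V.
Proof.
move=> hu E; rewrite /RicOp -[RHS](mulmxK hu); congr (_ *m _).
by apply/rowP => j; rewrite mxE E bil_delta.
Qed.

Lemma act_lower4 (R : realType) d (G : 'M[R]_d)
    (B C : 'rV[R]_d -> 'rV[R]_d -> 'rV[R]_d -> 'rV[R]_d) Xs X Y :
  act B (lower4 G C) Xs X Y =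
  - (bil G (C (B X Y (Xs 0)) (Xs 1) (Xs 2)) (Xs 3)
     + bil G (C (Xs 0) (B X Y (Xs 1)) (Xs 2)) (Xs 3)
     + bil G (C (Xs 0) (Xs 1) (B X Y (Xs 2))) (Xs 3)
     + bil G (C (Xs 0) (Xs 1) (Xs 2)) (B X Y (Xs 3))).
Proof.
rewrite /act /lower4 !big_ord_recl big_ord0 addr0 !addrA.
have -> : lift ord0 ord0 = 1 :> 'I_4 by exact: val_inj.
have -> : lift ord0 (lift ord0 ord0) = 2 :> 'I_4 by exact: val_inj.
have -> : lift ord0 (lift ord0 (lift ord0 ord0)) = 3 :> 'I_4 by exact: val_inj.
by [].
Qed.

(** * Algebra of trace-free curvature-like operators *)

Section CurvatureLikeOperator.
Variables (R : realType) (m : nat) (gm : 'M[R]_m).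
Notation vec := 'rV[R]_m.
Notation G := (bil gm).
Variable D : vec -> vec -> vec -> vec.
Hypotheses (gm_sym : gm^T = gm) (gm_unit : gm \in unitmx) (m_gt1 : (1 < m)%N).
Hypothesis D_linear1 : forall (k : R) u v b c,
  D (k *: u + v) b c = k *: D u b c + D v b c.
Hypothesis D_skew : forall u v c, D u v c = - D v u c.
Hypothesis D_trace : forall b c, \sum_i D (delta_mx 0 i) b c 0 i = 0.
Implicit Types (a b c u v y : vec).

Lemma curv_op0l b c : D 0 b c = 0.
Proof.
by apply: (addIr (D 0 b c)); rewrite add0r -{1}(scale1r (D 0 b c))
  -D_linear1 scaler0 addr0.
Qed.

Lemma curv_op0m b c : D b 0 c = 0.
Proof. by rewrite D_skew curv_op0l oppr0. Qed.


Lemma natrB1_neq0 : m%:R - 1 != 0 :> R.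
Proof.
by rewrite subr_eq0 -[X in _ != X]/(1%:R) eqr_nat; case: m m_gt1 => [|[]].
Qed.

Lemma bil_neq0 : exists a b, G a b != 0.
Proof.
apply/not_existsP => G0.
have m0 : (0 < m)%N by exact: ltnW.
have /rowP/(_ (Ordinal m0))/eqP : (const_mx 1 : vec) = 0.
  apply: (bil_inj gm_unit) => b; rewrite bil0l; apply/eqP/negPn/negP => Gb.
  by apply: (G0 (const_mx 1)); exists b.
by rewrite !mxE oner_eq0.
Qed.

Lemma sum_bil_delta a v : \sum_i G (delta_mx 0 i) a * v 0 i = G v a.
Proof. by rewrite -bil_sum. Qed.

(** The trace over [y] kills the term in [D], whereas the other term contributes
    [q * (m - 1) * G a b]. *)
Lemma no_constant_part (p q : R) :
  (forall y a b c, p * G (D y a b) c + q * (G a b * G y c - G y b * G a c) = 0) ->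
  q = 0.
Proof.
move=> E; have [a [b Gab]] := bil_neq0.
have V y : p *: D y a b + q *: (G a b *: y - G y b *: a) = 0.
  by apply: (bil_inj gm_unit) => c; rewrite !bilE E.
have : \sum_i (p *: D (delta_mx 0 i) a b
    + q *: (G a b *: delta_mx 0 i - G (delta_mx 0 i) b *: a)) 0 i = 0.
  by apply: big1 => i _; rewrite V mxE.
have entry (k l : R) (w1 w2 w3 : vec) i :
    (p *: w1 + q *: (k *: w2 - l *: w3)) 0 i
    = p * w1 0 i + q * (k * w2 0 i - l * w3 0 i) by rewrite !mxE.
under eq_bigr do rewrite entry.
rewrite big_split /= -!mulr_sumr D_trace mulr0 add0r sumrB.
rewrite -mulr_sumr sum_delta_diag sum_bil_delta => /eqP.
rewrite -[X in _ - X]mulr1 -mulrBr mulf_eq0 mulf_eq0 (negPf Gab).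
by rewrite (negPf natrB1_neq0) !orbF => /eqP.
Qed.

Hypothesis D_linear2 : forall (k : R) u v b c,
  D b (k *: u + v) c = k *: D b u c + D b v c.
Hypothesis D_linear3 : forall (k : R) u v b c,
  D b c (k *: u + v) = k *: D b c u + D b c v.
Hypothesis D_skew34 : forall u v b c, G (D u v b) c = - G b (D u v c).
Hypothesis D_bianchi : forall u v c, D u v c + D v c u + D c u v = 0.

Notation wG := (wedge G).

(* -Q(g, T)(a, b, c, d; u, v) for T the (0,4)-tensor of D *)
Definition wedge_action u v a b c d :=
  G (D (wG u v a) b c) d + G (D a (wG u v b) c) d
  + G (D a b (wG u v c)) d + G (D a b c) (wG u v d).

Let D_wedge1 u v a b c : D (wG u v a) b c = G v a *: D u b c - G u a *: D v b c.
Proof.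
by rewrite /wedge -!scaleNr D_linear1 -[_ *: v]addr0 D_linear1 curv_op0l addr0.
Qed.

Let D_wedge2 u v a b c : D b (wG u v a) c = G v a *: D b u c - G u a *: D b v c.
Proof.
by rewrite /wedge -!scaleNr D_linear2 -[_ *: v]addr0 D_linear2 curv_op0m addr0.
Qed.

Lemma curv_op0r b c : D b c 0 = 0.
Proof.
by apply: (addIr (D b c 0)); rewrite add0r -{1}(scale1r (D b c 0))
  -D_linear3 scaler0 addr0.
Qed.

Let D_wedge3 u v a b c : D b c (wG u v a) = G v a *: D b c u - G u a *: D b c v.
Proof.
by rewrite /wedge -!scaleNr D_linear3 -[_ *: v]addr0 D_linear3 curv_op0r addr0.
Qed.

(** The Bianchi identity and skew-symmetry reduce this trace to two traces over the first
    argument. *)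
Let D_trace3 b c : \sum_i D b c (delta_mx 0 i) 0 i = 0.
Proof.
have E i : D b c (delta_mx 0 i) 0 i
    = D (delta_mx 0 i) c b 0 i - D (delta_mx 0 i) b c 0 i.
  have /rowP/(_ i) := D_bianchi b c (delta_mx 0 i).
  rewrite (D_skew c) !mxE; lra.
by under eq_bigr do rewrite E; rewrite sumrB !D_trace subrr.
Qed.

(* The trace of the invariance identity over the direction [u] of the rotation is
   (m - 1) times the tensor, by the Bianchi identity. *)
Lemma rotation_invariant_eq0 :
  (forall u v a b c d, wedge_action u v a b c d = 0) ->
  forall a b c d, G (D a b c) d = 0.
Proof.
move=> inv a b c v.
(* The invariance identity with its last argument [d] removed by nondegeneracy, so that a trace over
   [u] can be taken. *)
have V u : G v a *: D u b c - G u a *: D v b c + (G v b *: D a u c - G u b *: D a v c)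
   + (G v c *: D a b u - G u c *: D a b v)
   + (G u (D a b c) *: v - G v (D a b c) *: u) = 0.
  apply: (bil_inj gm_unit) => d; rewrite bil0l -(inv u v a b c d).
  rewrite /wedge_action D_wedge1 D_wedge2 D_wedge3 /wedge !bilE.
  rewrite (bilC u (D a b c)) // (bilC v (D a b c)) //; ring.
have : \sum_i (G v a *: D (delta_mx 0 i) b c - G (delta_mx 0 i) a *: D v b c
   + (G v b *: D a (delta_mx 0 i) c - G (delta_mx 0 i) b *: D a v c)
   + (G v c *: D a b (delta_mx 0 i) - G (delta_mx 0 i) c *: D a b v)
   + (G (delta_mx 0 i) (D a b c) *: v - G v (D a b c) *: (delta_mx 0 i))) 0 i = 0.
  by apply: big1 => i _; rewrite V mxE.
have entry (k1 k2 k3 k4 k5 k6 k7 k8 : R) (w1 w2 w3 w4 w5 w6 w7 w8 : vec) i :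
    (k1 *: w1 - k2 *: w2 + (k3 *: w3 - k4 *: w4) + (k5 *: w5 - k6 *: w6)
      + (k7 *: w7 - k8 *: w8)) 0 i
    = k1 * w1 0 i - k2 * w2 0 i + (k3 * w3 0 i - k4 * w4 0 i)
      + (k5 * w5 0 i - k6 * w6 0 i) + (k7 * w7 0 i - k8 * w8 0 i).
  by rewrite !mxE.
under eq_bigr do rewrite entry.
rewrite !big_split /= !sumrN -!mulr_sumr !sum_bil_delta sum_delta_diag.
rewrite D_trace D_trace3.
under [X in G v b * X]eq_bigr do rewrite D_skew mxE.
rewrite sumrN D_trace !oppr0 !mulr0 !add0r.
have s34 x y z w : G (D x y z) w = - G (D x y w) z.
  by rewrite D_skew34 bilC.
have s12 x y z w : G (D x y z) w = - G (D y x z) w by rewrite D_skew bilNl.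
have bi : G (D v a b) c + G (D a b v) c + G (D b v a) c = 0.
  by rewrite -!bilDl D_bianchi bil0l.
rewrite (bilC v (D a b c)) // => E.
(* By the skew-symmetries, the three traced terms with [v] as an argument of [D] add up to the
   Bianchi sum [bi] and vanish. *)
have : (m%:R - 1) * G (D a b c) v = 0.
  have e1 := s34 v b c a; have e2 := s12 v b a c; have e3 := s12 a v c b.
  have e4 := s34 v a c b; have e5 := s34 a b v c.
  rewrite mulrBl mul1r; lra.
by move/eqP; rewrite mulf_eq0 (negPf natrB1_neq0) => /eqP.
Qed.

End CurvatureLikeOperator.

(** * The tensors of a warped product at a point *)

(* [A / f] and [sg / f] are the sectional curvatures of the planes containing,
   respectively orthogonal to, the base direction. *)
Section WarpedAlgebra.
Variables (R : realType) (m : nat) (gm : 'M[R]_m).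
Notation vec := 'rV[R]_m.
Notation G := (bil gm).
Variable D : vec -> vec -> vec -> vec.
Hypotheses (gm_sym : gm^T = gm) (gm_unit : gm \in unitmx) (m_gt1 : (1 < m)%N).
Hypothesis D_linear1 : forall (k : R) u v b c,
  D (k *: u + v) b c = k *: D u b c + D v b c.
Hypothesis D_linear2 : forall (k : R) u v b c,
  D b (k *: u + v) c = k *: D b u c + D b v c.
Hypothesis D_linear3 : forall (k : R) u v b c,
  D b c (k *: u + v) = k *: D b c u + D b c v.
Hypothesis D_skew : forall u v c, D u v c = - D v u c.
Hypothesis D_skew34 : forall u v b c, G (D u v b) c = - G b (D u v c).
Hypothesis D_bianchi : forall u v c, D u v c + D v c u + D c u v = 0.
Hypothesis D_trace : forall b c, \sum_i D (delta_mx 0 i) b c 0 i = 0.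

Variables (h : 'rV[R]_(1 + m) -> 'M[R]_(1 + m)) (x : 'rV[R]_(1 + m)).
Variables (e f A sg : R).
Hypotheses (e2 : e * e = 1) (f_neq0 : f != 0).
Hypothesis h_unit : h x \in unitmx.
Hypothesis h_bil : forall X Y,
  bil (h x) X Y = e * hd X * hd Y + f * G (tl X) (tl Y).
Hypothesis h_Riem : forall X Y Z, Riem h x X Y Z = wvec
  (A * (hd X * G (tl Y) (tl Z) - hd Y * G (tl X) (tl Z)))
  (D (tl X) (tl Y) (tl Z) + (- (e * A / f) * hd Z) *: (hd X *: tl Y - hd Y *: tl X)
   + sg *: (G (tl Y) (tl Z) *: tl X - G (tl X) (tl Z) *: tl Y)).
Implicit Types (X Y Z W : 'rV[R]_(1 + m)) (a b c d u v y : vec).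

Let m1_neq0 : m%:R - 1 != 0 :> R.
Proof. exact: natrB1_neq0. Qed.

Let m_neq0 : m%:R != 0 :> R.
Proof. by rewrite pnatr_eq0 -lt0n ltnW. Qed.

Let D0l b c : D 0 b c = 0. Proof. exact: curv_op0l. Qed.
Let D0m b c : D b 0 c = 0. Proof. exact: curv_op0m. Qed.

Let e_neq0 : e != 0.
Proof. by apply/eqP => e0; move/eqP: e2; rewrite e0 mul0r eq_sym oner_eq0. Qed.

Let D_scale1 k u b c : D (k *: u) b c = k *: D u b c.
Proof. by rewrite -[k *: u]addr0 D_linear1 D0l addr0. Qed.

Notation s := (A + (m%:R - 1) * sg).

Lemma Ric_warped X Y :
  Ric h x X Y = m%:R * (e * A / f) * hd X * hd Y + s * G (tl X) (tl Y).
Proof.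
rewrite /Ric trace_wvec h_Riem !hd_wvec tl_wvec bil0l mulr0 subr0 mul1r.
have entry i : tl (Riem h x (wvec 0 (delta_mx 0 i)) X Y) 0 i
  = D (delta_mx 0 i) (tl X) (tl Y) 0 i
    + (e * A / f) * hd Y * hd X * (delta_mx 0 i : vec) 0 i
    + (sg * G (tl X) (tl Y) * (delta_mx 0 i : vec) 0 i
       - sg * (G (delta_mx 0 i) (tl Y) * tl X 0 i)).
  rewrite h_Riem !tl_wvec hd_wvec scale0r sub0r !mxE; ring.
under [X in _ + X]eq_bigr do rewrite entry.
rewrite !big_split /= sumrN D_trace add0r -!mulr_sumr sum_delta_diag.
rewrite sum_bil_delta; ring.
Qed.

Lemma RicOp_warped X : RicOp h x X = wvec (m%:R * (A / f) * hd X) ((s / f) *: tl X).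
Proof.
apply: RicOp_unique => // W; rewrite Ric_warped h_bil hd_wvec tl_wvec bilZl.
congr (_ + _); first by ring.
by rewrite mulrA; congr (_ * _); field; exact: f_neq0.
Qed.

Lemma scal_warped : scal h x = m%:R * (A / f) + m%:R * (s / f).
Proof.
rewrite /scal trace_wvec RicOp_warped !hd_wvec mulr1; congr (_ + _).
under eq_bigr do rewrite RicOp_warped !tl_wvec mxE.
by rewrite -mulr_sumr sum_delta_diag mulrC.
Qed.

(** The Ricci and scalar corrections cancel all terms in [A] and [sg], in the base and in the fibre
    component alike. *)
Lemma Weyl_warped X Y Z : Weyl h x X Y Z = wvec 0 (D (tl X) (tl Y) (tl Z)).
Proof.
rewrite /Weyl h_Riem scal_warped !RicOp_warped.
elim/wvec_ind: X => x0 X; elim/wvec_ind: Y => y0 Y; elim/wvec_ind: Z => z0 Z.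
rewrite /wedge !h_bil !hd_wvec !tl_wvec !bilZl.
rewrite !(wvecZ, wvecN, wvecD) /=.
have -> : (1 + m)%:R - 2 = m%:R - 1 :> R by rewrite natrD; ring.
have -> : (1 + m)%:R - 1 = m%:R :> R by rewrite natrD; ring.
congr wvec.
  move: (G Y Z) (G X Z) => gYZ gXZ; field: e2.
  by rewrite f_neq0 m1_neq0 m_neq0.
apply/rowP => k; rewrite !mxE.
move: (G Y Z) (G X Z) (D X Y Z 0 k) => gYZ gXZ dk; field: e2.
by rewrite f_neq0 m1_neq0 m_neq0.
Qed.

(** For [A = sg] the part of the curvature apart from [D] has constant sectional curvature, and [D]
    does not contribute to the Ricci tensor. The contrapositive is what membership in [U_S]
    provides. *)
Lemma Einstein_warped : A = sg -> Einstein_at h x.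
Proof.
move=> AE X Y; rewrite Ric_warped scal_warped h_bil AE.
have -> : (1 + m)%:R = m%:R + 1 :> R by rewrite natrD addrC.
have m10 : m%:R + 1 != 0 :> R by rewrite natr1 pnatr_eq0.
field; rewrite f_neq0 andbT; exact: m10.
Qed.

Lemma C4_warped (Xs : 'I_4 -> 'rV[R]_(1 + m)) : C4 h x Xs =
  f * G (D (tl (Xs 0)) (tl (Xs 1)) (tl (Xs 2))) (tl (Xs 3)).
Proof.
by rewrite /C4 /lower4 Weyl_warped h_bil hd_wvec tl_wvec mulr0 mul0r add0r.
Qed.

Definition vec4 (X Y Z W : 'rV[R]_(1 + m)) : 'I_4 -> 'rV[R]_(1 + m) :=
  fun i => nth 0 [:: X; Y; Z; W] i.

Let simp0 := (@bil0l R, @bil0r R, @scale0r R, mulr0, mul0r, add0r, addr0, subr0, sub0r,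
  @scaler0 R, oppr0, mulr1, mul1r, @scale1r R, D0l, D0m).

Notation tg v := (wvec 0 v).
Notation dt := (wvec 1 (0 : vec)).

(** The rotation sends [dt] to a multiple of [tg y], which gives the right-hand side. In the other
    three terms [dt] stays in the first slot, where the Weyl tensor vanishes. *)
Lemma RC_mixed y a b c :
  RC h x (vec4 dt (tg a) (tg b) (tg c)) dt (tg y) = e * A * G (D y a b) c.
Proof.
rewrite /RC /C4 act_lower4 /vec4 /= !Weyl_warped !h_Riem !h_bil.
rewrite !(hd_wvec, tl_wvec) !simp0 D_scale1 bilZl; field; exact: f_neq0.
Qed.

(** The Weyl operator is zero as soon as one of its rotation vectors is [dt]. *)
Lemma CR_mixed y a b c :
  CR h x (vec4 dt (tg a) (tg b) (tg c)) dt (tg y) = 0.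
Proof.
rewrite /CR /R4 act_lower4 /vec4 /= !Weyl_warped !h_Riem !h_bil.
by rewrite !(hd_wvec, tl_wvec) !simp0.
Qed.

Lemma QSR_mixed y a b c :
  QSR h x (vec4 dt (tg a) (tg b) (tg c)) dt (tg y)
  = e * A * (m%:R * G (D y a b) c
             + (sg - A) * (G a b * G y c - G y b * G a c)).
Proof.
rewrite /QSR /Qtensor /R4 act_lower4 /vec4 /= /wedge !Ric_warped.
rewrite !hd_wvec !tl_wvec !(wvecZ, wvecN, wvecD) !h_Riem !h_bil.
rewrite !(hd_wvec, tl_wvec) !simp0.
rewrite -scaleNr D_scale1 !bilE; field; exact: f_neq0.
Qed.

Lemma Riem_tg u v a :
  Riem h x (tg u) (tg v) (tg a) = tg (D u v a + sg *: wedge G u v a).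
Proof. by rewrite h_Riem !(hd_wvec, tl_wvec) !simp0. Qed.

Lemma wedge_Ric_tg u v a :
  wedge (Ric h x) (tg u) (tg v) (tg a) = tg (s *: wedge G u v a).
Proof.
rewrite /wedge !Ric_warped !(hd_wvec, tl_wvec) !(wvecZ, wvecN, wvecD) !simp0.
by rewrite scalerBr !scalerA.
Qed.

Lemma bil_tg a b : bil (h x) (tg a) (tg b) = f * G a b.
Proof. by rewrite h_bil !(hd_wvec, tl_wvec) !simp0. Qed.

Lemma bil_Riem_tg a b c d :
  bil (h x) (tg (D a b c + sg *: wedge G a b c)) (tg d)
  = f * (G (D a b c) d + sg * (G b c * G a d - G a c * G b d)).
Proof. by rewrite bil_tg bilDl bilZl bilDl bilNl !bilZl. Qed.

(** The terms quadratic in [D] cancel, and [D u v], being skew for the metric, annihilates the part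
    of [R] built from the metric. There remains the rotation of [D] by [sg *: wedge G u v]. *)
Lemma RC_CR_tg u v a b c d :
  let Xs := vec4 (tg a) (tg b) (tg c) (tg d) in
  RC h x Xs (tg u) (tg v) - CR h x Xs (tg u) (tg v)
  = - (f * sg) * wedge_action gm D u v a b c d.
Proof.
move=> Xs; rewrite /RC /CR /C4 /R4 !act_lower4 /Xs /vec4 /=.
rewrite !Riem_tg !Weyl_warped !tl_wvec.
rewrite !Riem_tg !bil_Riem_tg !bil_tg /wedge_action.
have l1 p q k y z : D (p + k *: q) y z = D p y z + k *: D q y z.
  by rewrite addrC D_linear1 addrC.
have l2 p q k y z : D y (p + k *: q) z = D y p z + k *: D y q z.
  by rewrite addrC D_linear2 addrC.
have l3 p q k y z : D y z (p + k *: q) = D y z p + k *: D y z q.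
  by rewrite addrC D_linear3 addrC.
move: (wedge G u v a) (wedge G u v b) (wedge G u v c) (wedge G u v d) => qa qb qc qd.
rewrite l1 l2 l3 !(bilDl, bilZl) bilDr bilZr.
rewrite (D_skew34 u v a d) (D_skew34 u v a c) (D_skew34 u v b c) (D_skew34 u v b d).
ring.
Qed.

(** On fibre vectors the Ricci tensor is [s] times [G], and the part of [R] built from [G] is
    invariant under the rotations [wedge G u v]. *)
Lemma QSR_tg u v a b c d :
  QSR h x (vec4 (tg a) (tg b) (tg c) (tg d)) (tg u) (tg v)
  = - (f * s) * wedge_action gm D u v a b c d.
Proof.
rewrite /QSR /Qtensor /R4 act_lower4 /vec4 /= !wedge_Ric_tg.
rewrite !Riem_tg !bil_Riem_tg.
have l1 q k y z : D (k *: q) y z = k *: D q y z by rewrite D_scale1.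
have l2 q k y z : D y (k *: q) z = k *: D y q z.
  by rewrite -[k *: q]addr0 D_linear2 D0m addr0.
have l3 q k y z : D y z (k *: q) = k *: D y z q.
  by rewrite -[k *: q]addr0 D_linear3 (curv_op0r D_linear3) addr0.
rewrite l1 l2 l3 /wedge_action !bilZl !bilZr.
have w1 y z : G (wedge G u v y) z = G v y * G u z - G u y * G v z.
  by rewrite /wedge !bilE.
have w2 y z : G z (wedge G u v y) = G v y * G u z - G u y * G v z.
  by rewrite bilC // w1.
have w3 : G (D a b c) (wedge G u v d) = G v d * G (D a b c) u - G u d * G (D a b c) v.
  by rewrite /wedge !bilE.
rewrite !w3 !(w1, w2).
move: (G (D (wedge G u v a) b c) d) (G (D a (wedge G u v b) c) d)
  (G (D a b (wedge G u v c)) d) => t1 t2 t3.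
ring.
Qed.

(** If [A] were nonzero, the mixed component of [Q(S,R)] divided by [e * A] would have [sg - A] as
    its constant part, which must then vanish. *)
Lemma radial_eq0_of_QSR : A != sg ->
  (forall Xs X Y, QSR h x Xs X Y = 0) -> A = 0.
Proof.
move=> Asg Q0; apply/eqP/negPn/negP => A0.
have : sg - A = 0.
  apply: (no_constant_part gm_unit m_gt1 D_trace (p := m%:R)) => y a b c.
  have /eqP := Q0 (vec4 dt (tg a) (tg b) (tg c)) dt (tg y).
  by rewrite QSR_mixed mulf_eq0 (negPf (mulf_neq0 e_neq0 A0)) => /eqP.
by move/eqP; rewrite subr_eq0 eq_sym (negPf Asg).
Qed.

Hypothesis D_neq0 : exists a b c d, G (D a b c) d != 0.

(** If [A] were nonzero, dividing the mixed component by [e * A] and taking the constant part would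
    give [L * (sg - A) = 0], hence [L = 0]; the same component would then read [D = 0]. *)
Lemma radial_eq0 (L : R) : A != sg ->
  (forall Xs X Y, RC h x Xs X Y - CR h x Xs X Y = L * QSR h x Xs X Y) -> A = 0.
Proof.
move=> Asg LQ; apply/eqP/negPn/negP => A0.
have E y a b c : G (D y a b) c
    = L * (m%:R * G (D y a b) c + (sg - A) * (G a b * G y c - G y b * G a c)).
  have := LQ (vec4 dt (tg a) (tg b) (tg c)) dt (tg y).
  rewrite RC_mixed CR_mixed QSR_mixed subr0 mulrCA.
  by move/(mulfI (mulf_neq0 e_neq0 A0)).
have : L * (sg - A) = 0.
  apply: (no_constant_part gm_unit m_gt1 D_trace (p := L * m%:R - 1)) => y a b c.
  have := E y a b c; move: (G (D y a b) c) => t tE.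
  rewrite mulrBl mul1r {2}tE; ring.
move/eqP; rewrite mulf_eq0 subr_eq0 [sg == A]eq_sym (negPf Asg) orbF => /eqP L0.
have [a [b [c [d]]]] := D_neq0.
by rewrite E L0 mul0r eqxx.
Qed.

(** For [A = 0] one has [s = (m - 1) * sg], and the fibre components say that
    [f * sg * (1 - L * (m - 1))] annihilates [wedge_action]. A nonzero factor would make [D]
    rotation invariant, hence zero. *)
Lemma coefficient_eq (L : R) : A = 0 -> sg != 0 ->
  (forall Xs X Y, RC h x Xs X Y - CR h x Xs X Y = L * QSR h x Xs X Y) ->
  L = (m%:R - 1)^-1.
Proof.
move=> A0 sg0 LQ; apply/eqP/negPn/negP => Lm.
have L1 : 1 - L * (m%:R - 1) != 0.
  apply: contra Lm; rewrite subr_eq0 => /eqP E.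
  by apply/eqP; apply: (mulIf m1_neq0); rewrite -E mulVf.
have [a [b [c [d]]]] := D_neq0.
rewrite (rotation_invariant_eq0 gm_sym gm_unit m_gt1 D_linear1 D_skew D_trace
  D_linear2 D_linear3 D_skew34 D_bianchi) ?eqxx // => u v {}a {}b {}c {}d.
have := LQ (vec4 (tg a) (tg b) (tg c) (tg d)) (tg u) (tg v).
rewrite RC_CR_tg QSR_tg A0 add0r => E.
have : f * sg * (1 - L * (m%:R - 1)) * wedge_action gm D u v a b c d = 0.
  by move: E; move: (wedge_action _ _ _ _ _ _ _ _) => w E; lra.
move/eqP; rewrite mulf_eq0 mulf_eq0 (negPf L1) orbF.
by rewrite (negPf (mulf_neq0 f_neq0 sg0)) => /eqP.
Qed.

End WarpedAlgebra.

(** * The radial equation *)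

Section RealLine.
Variable R : realType.
Implicit Types (f g : R -> R) (s t : R).

Lemma is_derive_div f g (f' g' : R) t :
  is_derive t 1 f f' -> is_derive t 1 g g' -> g t != 0 ->
  is_derive t 1 (fun s => f s / g s) (f' / g t - f t * g' / g t ^+ 2).
Proof.
move=> df [dg gE] g0.
have dV : is_derive t 1 (fun s => (g s)^-1) (- (g t) ^- 2 *: g').
  by split; [exact: derivableV|rewrite deriveV // gE].
apply: is_derive_eq (is_deriveM df dV) _.
rewrite -![_ *: _]/(_ * _); field; exact: g0.
Qed.

Lemma constant_of_derive0 f (x y : R) : x <= y ->
  (forall s, x <= s <= y -> is_derive s 1 f 0) -> f x = f y.
Proof.
move=> xy df.
have D s : s \in `[x, y] -> is_derive s 1 f 0 by rewrite in_itv; exact: df.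
have Doo s : s \in `]x, y[ -> is_derive s 1 f 0.
  by move=> sxy; apply: D; exact: subset_itv_oo_cc.
have cf : {within `[x, y], continuous f}.
  by apply: derivable_within_continuous => s /D[].
have [s _] := MVT_segment xy Doo cf.
by rewrite mul0r => /eqP; rewrite subr_eq0 => /eqP.
Qed.

Lemma constant_on_interval f (J : set R) : is_interval J ->
  (forall s, J s -> is_derive s 1 f 0) -> forall x y, J x -> J y -> f x = f y.
Proof.
move=> Jitv df x y Jx Jy.
wlog xy : x y Jx Jy / x <= y => [H|].
  by have [/H|/ltW /H e] := leP x y; [exact|apply/esym; exact: e].
by apply: constant_of_derive0 => // s sxy; apply: df; exact: Jitv sxy.
Qed.

Lemma near_neq f t (c : R) : {for t, continuous f} -> f t != c ->
  \forall s \near t, f s != c.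
Proof.
move=> cf fc; have A : nbhs (f t) [set y | y != c].
  by apply: open_nbhs_nbhs; split => //; exact: open_neq.
exact: cf A.
Qed.

End RealLine.

Section RadialEquation.
Variables (R : realType) (eps : R) (I : set R) (F : R -> R).
Hypotheses (I_open : open I) (I_itv : is_interval I).
Hypotheses (F_smooth : smooth I F) (F_gt0 : forall t, I t -> 0 < F t).
Notation F1 := (der F).
Notation F2 := (der (der F)).

Let F_neq0 t : I t -> F t != 0.
Proof. by move=> /F_gt0; rewrite lt0r => /andP[]. Qed.

Let is_derive_F t : I t -> is_derive t 1 F (F1 t).
Proof.
move=> It; have [_ [/(_ _ It) + _]] := F_smooth 1.
by move/derivable1_diffP => df; apply: derivableP.
Qed.

Let is_derive_F1 t : I t -> is_derive t 1 F1 (F2 t).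
Proof.
move=> It; have [_ [_ /(_ 1)[_ [/(_ _ It) + _]]]] := F_smooth 2.
by move/derivable1_diffP => df; apply: derivableP.
Qed.

Let is_derive_F2 t : I t -> derivable F2 t 1.
Proof.
move=> It; have [_ [_ /(_ 1)[_ [_ /(_ 1)[_ [/(_ _ It) + _]]]]]] := F_smooth 3.
by move/derivable1_diffP.
Qed.

(* eps ((sqrt F)')^2 *)
Definition slope t : R := eps * F1 t ^+ 2 / (4 * F t).

Let is_derive_slope t : I t ->
  is_derive t 1 slope (eps / 2 * (F1 t / F t) * radial F t).
Proof.
move=> It; have F0 := F_neq0 It.
have d1 := is_derive_F It; have d2 := is_derive_F1 It.
have d3 : is_derive t 1 (eps \*: (F1 * F1)) (eps *: (F1 t *: F2 t + F1 t *: F2 t)).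
  exact: is_deriveZ.
have d4 : is_derive t 1 (4 \*: F) (4 *: F1 t) by exact: is_deriveZ.
have F40 : (4 \*: F) t != 0 by apply: mulf_neq0.
have E : slope = (fun s => (eps \*: (F1 * F1)) s / (4 \*: F) s).
  by apply/funext => s; rewrite /slope expr2.
rewrite E; apply: is_derive_eq (is_derive_div d3 d4 F40) _.
rewrite /radial -![_ *: _]/(_ * _) !fctE /= -![_ *: _]/(_ * _).
move: (F1 t) (F2 t) (F t) F0 => f1 f2 f f0; field; exact: f0.
Qed.

Let continuous_slope t : I t -> {for t, continuous slope}.
Proof.
move=> It; apply: differentiable_continuous; apply/derivable1_diffP.
by have [] := is_derive_slope It.
Qed.

Let continuous_radial t : I t -> {for t, continuous (radial F)}.
Proof.
move=> It; have F0 := F_neq0 It.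
apply: differentiable_continuous; apply/derivable1_diffP.
have d1 := is_derive_F It; have d2 := is_derive_F1 It.
have d4 : is_derive t 1 (2 \*: F) (2 *: F1 t) by exact: is_deriveZ.
have F40 : (2 \*: F) t != 0 by apply: mulf_neq0.
have d5 := is_derive_div (is_deriveM d2 d2) d4 F40.
have E : radial F = F2 - (fun s => (F1 * F1) s / (2 \*: F) s).
  by apply/funext => s; rewrite /radial expr2.
by rewrite E; apply: derivableB => //; exact: is_derive_F2.
Qed.

(* The set where [radial F] vanishes and [slope] keeps its initial value is open and
   closed in [I]. *)
Lemma radial_eq0_everywhere (K t0 : R) : I t0 ->
  (forall t, I t -> - (eps / 2) * radial F t != K - slope t ->
     radial F t = 0) ->
  - (eps / 2) * radial F t0 != K - slope t0 ->
  forall t, I t -> radial F t = 0.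
Proof.
move=> It0 H Ht0.
have r0 := H _ It0 Ht0.
pose B := [set t | I t /\ (radial F t = 0 /\ slope t = slope t0)].
suff BI : B = I by move=> t; rewrite -BI => -[_ []].
(* The three remaining goals are that [B] is nonempty, relatively open and relatively closed in
   [I]. *)
apply: (connected_intervalP I).2 => //.
- by exists t0.
- exists B; last by apply/seteqP; split => t; [move=> Bt; split => //; case: Bt|case].
  rewrite openE => t [It [rt st]]; rewrite /interior.
  (* At [t] this difference has its nonzero value from [t0]. It stays nonzero nearby, so that [H]
     gives [radial F = 0] on a ball, where [slope] is therefore constant. *)
  have ct : {for t, continuous (fun s => - (eps / 2) * radial F s - (K - slope s))}.
    apply: continuousB.
      by apply: continuousM; [exact: cst_continuous|exact: continuous_radial].
    by apply: continuousB; [exact: cst_continuous|exact: continuous_slope].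
  have nz : \forall s \near t, - (eps / 2) * radial F s - (K - slope s) != 0.
    by apply: (near_neq ct); rewrite rt st; move: Ht0; rewrite r0 -subr_eq0.
  have nI : \forall s \near t, I s by exact: open_nbhs_nbhs.
  have /nbhs_ballP[r /= rp rB] : \forall s \near t, I s /\ radial F s = 0.
    near=> s; have Is : I s by near: s.
    by split => //; apply: H => //; rewrite -subr_eq0; near: s.
  apply/nbhs_ballP; exists r => //= s ts.
  have [Is rs] := rB _ ts; split => //; split => //; rewrite -st.
  apply: (@constant_on_interval _ slope (ball t r)) => //.
  + by rewrite ball_itv; exact: interval_is_interval.
  + move=> u /rB[Iu ru].
    by apply: is_derive_eq (is_derive_slope Iu) _; rewrite ru mulr0.
  + exact: ballxx.
(* [B] is cut out of [I] by two equations between continuous functions, so a point of [I] in its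
   closure satisfies them. *)
- exists (closure B); first exact: closed_closure.
  apply/seteqP; split => [t Bt|t [It clB]].
    by split; [case: Bt|exact: subset_closure].
  split => //; split; apply/eqP; apply: contraT => ne.
    have : \forall s \near t, radial F s != 0.
      exact: near_neq (continuous_radial It) ne.
    by move/clB => [s [[_ [rs _]]]] /=; rewrite rs eqxx.
  have : \forall s \near t, slope s != slope t0.
    exact: near_neq (continuous_slope It) ne.
  by move/clB => [s [[_ [_ ss]]]] /=; rewrite ss eqxx.
Unshelve. all: by end_near. Qed.

(** [radial F] is [2 * r * r''] for [r = sqrt F], so its vanishing makes [r'] constant on the
    interval. *)
Lemma square_of_affine : I !=set0 -> (forall t, I t -> radial F t = 0) ->
  exists a b : R, forall t, I t -> F t = (a * t + b) ^+ 2.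
Proof.
move=> [t0 It0] rad0.
pose r t := Num.sqrt (F t); pose r' t := F1 t / (2 * r t).
have r_neq0 t : I t -> r t != 0 by move=> It; rewrite gt_eqF // sqrtr_gt0 F_gt0.
have rr t : I t -> r t * r t = F t.
  by move=> It; rewrite -expr2 sqr_sqrtr // ltW // F_gt0.
have dr t : I t -> is_derive t 1 r (r' t).
  move=> It; have d1 := is_derive_F It; have d2 := is_derive1_sqrt (F_gt0 It).
  by apply: is_derive_eq (is_derive1_comp d2 d1) _; rewrite mulrC.
have dr' t : I t -> is_derive t 1 r' 0.
  move=> It; have d1 := is_derive_F1 It.
  have d2 : is_derive t 1 (2 \*: r) (2 *: r' t) by apply: is_deriveZ; exact: dr.
  have r0 := r_neq0 _ It.
  have r20 : (2 \*: r) t != 0 by apply: mulf_neq0.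
  apply: is_derive_eq (is_derive_div d1 d2 r20) _.
  have := rad0 _ It; rewrite /radial => /eqP; rewrite subr_eq0 => /eqP ->.
  rewrite -(rr _ It) -![_ *: _]/(_ * _) ?fctE /= -?[_ *: _]/(_ * _) /r'.
  move: (F1 t) (r t) r0 => f1 q q0; field; exact: q0.
(* The coefficients of the tangent line to [sqrt F] at [t0]. *)
exists (r' t0), (r t0 - r' t0 * t0) => t It.
have E : r t - r' t0 * t = r t0 - r' t0 * t0.
  apply: (@constant_on_interval _ (fun s => r s - r' t0 * s) I) => // s Is.
  have d1 := dr _ Is.
  have d2 : is_derive s 1 (r' t0 \*: id) (r' t0 *: 1) by exact: is_deriveZ.
  apply: is_derive_eq (is_deriveB d1 d2) _.
  rewrite -[_ *: _]/(_ * _) mulr1.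
  by rewrite (@constant_on_interval _ r' I I_itv dr' s t0) // subrr.
by rewrite -E addrC subrK expr2 rr.
Qed.

End RadialEquation.

(** * The warped product with an Einstein fibre *)

Section Wedge.
Variables (R : realType) (m : nat) (gm : 'M[R]_m).
Implicit Types (u v b c : 'rV[R]_m).
Notation W := (wedge (bil gm)).

Lemma wedge_linear1 (k : R) u v b c : W (k *: u + v) b c = k *: W u b c + W v b c.
Proof. by rewrite /wedge !bilE; apply/rowP => i; rewrite !mxE; ring. Qed.

Lemma wedge_linear2 (k : R) u v b c : W b (k *: u + v) c = k *: W b u c + W b v c.
Proof. by rewrite /wedge !bilE; apply/rowP => i; rewrite !mxE; ring. Qed.

Lemma wedge_linear3 (k : R) u v b c : W b c (k *: u + v) = k *: W b c u + W b c v.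
Proof. by rewrite /wedge !bilE; apply/rowP => i; rewrite !mxE; ring. Qed.

Lemma wedge_skew u v c : W u v c = - W v u c.
Proof. by rewrite /wedge opprB. Qed.

Lemma wedge_skew34 u v b c : gm^T = gm -> bil gm (W u v b) c = - bil gm b (W u v c).
Proof. by move=> gs; rewrite /wedge !bilE (bilC b v) // (bilC b u) //; ring. Qed.

Lemma wedge_bianchi u v c : gm^T = gm -> W u v c + W v c u + W c u v = 0.
Proof.
move=> gs; rewrite /wedge (bilC v u) // (bilC v c) // (bilC c u) //.
by apply/rowP => i; rewrite !mxE; ring.
Qed.

End Wedge.

Lemma sub_linear (R : realType) m (k q : R) (r1 r2 w1 w2 : 'rV[R]_m) :
  k *: r1 + r2 - q *: (k *: w1 + w2) = k *: (r1 - q *: w1) + (r2 - q *: w2).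
Proof. by apply/rowP => i; rewrite !mxE; ring. Qed.

Lemma sub_skew (R : realType) m (q : R) (r r' w w' : 'rV[R]_m) :
  r = - r' -> w = - w' -> r - q *: w = - (r' - q *: w').
Proof. by move=> -> ->; rewrite scalerN opprD. Qed.

Lemma sub_cyclic (R : realType) m (q : R) (r1 r2 r3 w1 w2 w3 : 'rV[R]_m) :
  r1 + r2 + r3 = 0 -> w1 + w2 + w3 = 0 ->
  r1 - q *: w1 + (r2 - q *: w2) + (r3 - q *: w3) = 0.
Proof.
move=> r0 w0; rewrite [LHS](_ : _ = r1 + r2 + r3 - q *: (w1 + w2 + w3)).
  by rewrite r0 w0 scaler0 subr0.
by apply/rowP => i; rewrite !mxE; ring.
Qed.

Lemma entry_sub (R : realType) m (q k l : R) (r w b : 'rV[R]_m) i :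
  (r - q *: (k *: w - l *: b)) 0 i = r 0 i - (q * k * w 0 i - q * (l * b 0 i)).
Proof. by rewrite !mxE; ring. Qed.

(** Regroups the fibre curvature into its part [r - q *: w], with [w] the wedge term, and a multiple
    of [w]; [q] will be [model_curv] and [k] will be [slope]. *)
Lemma curv_split (R : realType) m (k q c x0 y0 gYZ gXZ : R) (r X Y : 'rV[R]_m) :
  r + c *: (x0 *: Y - y0 *: X) - k *: (gYZ *: X - gXZ *: Y)
  = r - q *: (gYZ *: X - gXZ *: Y) + c *: (x0 *: Y - y0 *: X)
    + (q - k) *: (gYZ *: X - gXZ *: Y).
Proof. by apply/rowP => i; rewrite !mxE; ring. Qed.

Section WarpedProduct.
Variables (R : realType) (m : nat) (eps : R) (I : set R) (F : R -> R).
Variable N : semiRiemannian R m.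
Hypotheses (m_gt1 : (1 < m)%N) (eps2 : eps * eps = 1).
Hypotheses (I_open : open I) (F_smooth : smooth I F).
Hypothesis F_gt0 : forall t, I t -> 0 < F t.
Hypothesis N_einstein : Einstein N.
Implicit Types (t : R) (y : N).

Notation gy y := (gram y).
Notation zy y := (own_coord y).
Notation Gy y := (bil (gram y (own_coord y))).

(* the paper's C_1 *)
Definition model_curv y : R := scalar_curvature y / (m%:R * (m%:R - 1)).

(* This is the Weyl operator because the fibre is Einstein. *)
Definition fibre_weyl y (u v w : 'rV[R]_m) : 'rV[R]_m :=
  Riem (gy y) (zy y) u v w - model_curv y *: wedge (Gy y) u v w.

Let O_open y : open (cimg (chart_at y)).
Proof. by case: (chart_atP y). Qed.

Let O_coord y : cimg (chart_at y) (zy y).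
Proof. by exists y => //; exact: chart_at_dom. Qed.

Let g_sym y : (gy y (zy y))^T = gy y (zy y).
Proof. exact: gram_sym. Qed.

Let g_unit y : gy y (zy y) \in unitmx.
Proof. exact: gram_nondeg. Qed.

Let W_linear1 y k u v b c : fibre_weyl y (k *: u + v) b c
  = k *: fibre_weyl y u b c + fibre_weyl y v b c.
Proof.
rewrite /fibre_weyl (Riem_linear1 (@O_open y) (@gram_smooth _ _ N y) (@gram_nondeg _ _ N y)) //.
by rewrite wedge_linear1 sub_linear.
Qed.

Let W_linear2 y k u v b c : fibre_weyl y b (k *: u + v) c
  = k *: fibre_weyl y b u c + fibre_weyl y b v c.
Proof.
rewrite /fibre_weyl (Riem_linear2 (@O_open y) (@gram_smooth _ _ N y) (@gram_nondeg _ _ N y)) //.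
by rewrite wedge_linear2 sub_linear.
Qed.

Let W_linear3 y k u v b c : fibre_weyl y b c (k *: u + v)
  = k *: fibre_weyl y b c u + fibre_weyl y b c v.
Proof.
rewrite /fibre_weyl (Riem_linear3 (@O_open y) (@gram_smooth _ _ N y) (@gram_nondeg _ _ N y)) //.
by rewrite wedge_linear3 sub_linear.
Qed.

Let W_skew y u v c : fibre_weyl y u v c = - fibre_weyl y v u c.
Proof.
exact: sub_skew (Riem_skew _ _ _ _ _) (wedge_skew _ _ _ _).
Qed.

Let W_skew34 y u v b c : Gy y (fibre_weyl y u v b) c = - Gy y b (fibre_weyl y u v c).
Proof.
rewrite /fibre_weyl bilDl bilDr.
rewrite (Riem_skew34 (@O_open y) (@gram_smooth _ _ N y) (@gram_sym _ _ N y)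
  (@gram_nondeg _ _ N y)) //.
rewrite opprD; congr (_ + _).
by rewrite bilNl bilNr bilZl bilZr wedge_skew34 // mulrN.
Qed.

Let W_bianchi y u v c :
  fibre_weyl y u v c + fibre_weyl y v c u + fibre_weyl y c u v = 0.
Proof.
apply: sub_cyclic; last exact: wedge_bianchi.
exact: (bianchi (@O_open y) (@gram_smooth _ _ N y) (@gram_sym _ _ N y)
  (@gram_nondeg _ _ N y) u v c (O_coord y)).
Qed.

Let m1_neq0 : m%:R - 1 != 0 :> R.
Proof. exact: natrB1_neq0. Qed.

Let m_neq0 : m%:R != 0 :> R.
Proof. by rewrite pnatr_eq0 -lt0n ltnW. Qed.

(** The Einstein condition enters here: the Ricci tensor of the fibre is [(m - 1) * model_curv y]
    times the metric, exactly the trace of the subtracted wedge term. *)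
Let W_trace y b c : \sum_i fibre_weyl y (delta_mx 0 i) b c 0 i = 0.
Proof.
have entry i : fibre_weyl y (delta_mx 0 i) b c 0 i
  = Riem (gy y) (zy y) (delta_mx 0 i) b c 0 i
    - (model_curv y * Gy y b c * (delta_mx 0 i : 'rV[R]_m) 0 i
       - model_curv y * (Gy y (delta_mx 0 i) c * b 0 i)).
  exact: entry_sub.
have Ein : \sum_i Riem (gy y) (zy y) (delta_mx 0 i) b c 0 i
    = scalar_curvature y / m%:R * Gy y b c.
  apply: etrans (N_einstein y b c).
  by rewrite /Ric /trace_of /mxtrace; apply: eq_bigr => i _; rewrite [RHS]mxE.
under eq_bigr do rewrite entry.
rewrite sumrB Ein sumrB -!mulr_sumr sum_delta_diag sum_bil_delta /model_curv.
by field; rewrite m1_neq0 m_neq0.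
Qed.

Notation A t := (- (eps / 2) * radial F t).
Notation sg t y := (model_curv y - slope eps F t).

(** [wx] and [wh] agree with [wcoord] and [wmetric] up to conversion, so results about them apply to
    the tensors of the statement. *)
Let wx t y : 'rV[R]_(1 + m) := wvec t (zy y).
Let wh y := wmet eps F (gy y).

Let wdom_wx t y : I t -> wdom I (cimg (chart_at y)) (wx t y).
Proof. by move=> It; split; rewrite ?hd_wvec ?tl_wvec. Qed.

Let wh_unit t y : I t -> wh y (wx t y) \in unitmx.
Proof.
move=> It; exact: (wmet_unit eps2 F_gt0 (@gram_nondeg _ _ N y) (wdom_wx y It)).
Qed.

Let wh_bil t y X Y : bil (wh y (wx t y)) X Y
  = eps * hd X * hd Y + F t * Gy y (tl X) (tl Y).
Proof. by rewrite /wh bil_wmet /wx hd_wvec tl_wvec. Qed.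

Let F_neq0 t : I t -> F t != 0.
Proof. by move=> It; rewrite gt_eqF // F_gt0. Qed.

Let wh_Riem t y : I t -> forall X Y Z, Riem (wh y) (wx t y) X Y Z = wvec
  (A t * (hd X * Gy y (tl Y) (tl Z) - hd Y * Gy y (tl X) (tl Z)))
  (fibre_weyl y (tl X) (tl Y) (tl Z)
   + (- (eps * A t / F t) * hd Z) *: (hd X *: tl Y - hd Y *: tl X)
   + sg t y *: (Gy y (tl Y) (tl Z) *: tl X - Gy y (tl X) (tl Z) *: tl Y)).
Proof.
move=> It X Y Z.
have := Riem_warped eps2 I_open F_smooth F_gt0 (@O_open y) (@gram_smooth _ _ N y)
  (@gram_sym _ _ N y) (@gram_nondeg _ _ N y) X Y Z (wdom_wx y It).
rewrite /= /wx hd_wvec tl_wvec => ->; congr wvec.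
have -> : - (eps * A t / F t) = eps * eps * radial F t / (2 * F t).
  by field; exact: F_neq0.
rewrite eps2 mul1r; exact: curv_split.
Qed.

Let Weyl_neq0 y := exists a b c d, Gy y (fibre_weyl y a b c) d != 0.

Lemma U_C_fibre p : U_C eps I F N p -> Weyl_neq0 p.2.
Proof.
case: p => t y [It [Xs]].
rewrite (C4_warped m_gt1 (W_trace y) eps2 (F_neq0 It) (wh_unit y It) (wh_bil t y) (wh_Riem y It)).
move=> C0; exists (tl (Xs 0)), (tl (Xs 1)), (tl (Xs 2)), (tl (Xs 3)).
by apply: contra C0 => /eqP ->; rewrite mulr0.
Qed.

Lemma U_S_neq p : U_S eps I F N p -> A p.1 != sg p.1 p.2.
Proof.
case: p => t y [It nE]; apply/eqP => /= E; apply: nE.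
exact: (Einstein_warped (W_trace y) (F_neq0 It) (wh_unit y It) (wh_bil t y) (wh_Riem y It)).
Qed.

Variable L : R * N -> R.
Hypothesis L_eq : forall p, U_QSR eps I F N p -> forall Xs X Y,
  wRC eps F p Xs X Y - wCR eps F p Xs X Y = L p * wQSR eps F p Xs X Y.

(** The equation with [L] is available on [U_QSR] only; elsewhere the vanishing of [Q(S,R)] gives
    the same conclusion. Hence [t] may range over the whole interval with [y] fixed, as the
    propagation argument requires. *)
Lemma radial_vanishes t y : I t -> Weyl_neq0 y -> A t != sg t y -> radial F t = 0.
Proof.
move=> It W0 Asg.
suff : A t = 0.
  move/eqP; rewrite mulf_eq0 oppr_eq0 mulf_eq0 invr_eq0 pnatr_eq0 orbF.
  case/orP => /eqP // e0; move/eqP: eps2.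
  by rewrite e0 mul0r eq_sym oner_eq0.
have [U|nU] := pselect (U_QSR eps I F N (t, y)).
  exact: (radial_eq0 (g_unit y) m_gt1 (W_linear1 y) (W_trace y) eps2
    (F_neq0 It) (wh_unit y It) (wh_bil t y) (wh_Riem y It) W0 Asg (L_eq U)).
apply: (radial_eq0_of_QSR (g_unit y) m_gt1 (W_linear1 y) (W_trace y) eps2
    (F_neq0 It) (wh_bil t y) (wh_Riem y It) Asg) => Xs X Y.
apply/eqP; apply: contraT => Q0.
by case: nU; split => //; exists Xs, X, Y.
Qed.

Lemma L_value p : U_QSR eps I F N p -> U_S eps I F N p -> U_C eps I F N p ->
  L p = (m%:R - 1)^-1.
Proof.
case: p => t y UQ US UC; have [It _] := UQ.
have /= Asg := U_S_neq US; have /= W0 := U_C_fibre UC.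
have r0 := radial_vanishes It W0 Asg.
have A0 : A t = 0 by rewrite r0 mulr0.
apply: (coefficient_eq (g_sym y) (g_unit y) m_gt1 (W_linear1 y) (W_linear2 y)
  (W_linear3 y) (W_skew y) (W_skew34 y) (W_bianchi y) (W_trace y) eps2
  (F_neq0 It) (wh_unit y It) (wh_bil t y) (wh_Riem y It) W0 A0 _ (L_eq UQ)).
(* As [A t = 0], the inequality [A t != sg t y] says that [sg t y] is nonzero. *)
by rewrite eq_sym -A0.
Qed.

End WarpedProduct.

Theorem theorem5p1 (R : realType) (n : nat) (n_ge4 : (4 <= n)%N)
    (eps : R) (eps_pm1 : eps = 1 \/ eps = -1)
    (I : set R) (I_open : open I) (I_itv : is_interval I) (I_neq0 : I !=set0)
    (N : semiRiemannian R n.-1) (N_einstein : Einstein N)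
    (F : R -> R) (F_smooth : smooth I F) (F_gt0 : forall t, I t -> 0 < F t)
    (L : R * N -> R)
    (h : forall p, U_QSR eps I F N p ->
       forall Xs X Y,
         wRC eps F p Xs X Y - wCR eps F p Xs X Y = L p * wQSR eps F p Xs X Y) :
  let C1 (p : R * N) :=
    scalar_curvature p.2 / ((n%:R - 1) * (n%:R - 2)) in
  let UU := U_QSR eps I F N `&` U_S eps I F N
              `&` U_C eps I F N in
  [\/ (forall p, UU p -> L p = (n%:R - 2)^-1) /\
      (exists a b : R, forall p, UU p -> F p.1 = (a * p.1 + b) ^+ 2),
      (forall p, UU p -> L p = (n%:R - 1)^-1) /\
      (exists b c s : R, [/\ 0 < c, b != 0, s = 1 \/ s = -1 &
         forall p, UU p ->
           F p.1 = c / 2 *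
             (expR (s * (b / 2) * p.1)
              - 2 * eps * C1 p / (b ^+ 2 * c)
                * expR (- s * (b / 2) * p.1)) ^+ 2])
    | (forall p, UU p -> L p = (n%:R - 1)^-1) /\
      (exists b c : R, forall p, UU p ->
         0 < eps * C1 p / c /\
         F p.1 = 2 * eps * C1 p / c * (1 + sin (c * p.1 + b)))].
Proof.
case: n n_ge4 N N_einstein L h => [//|m] m_ge3 N N_einstein L h C1 UU.
have eps2 : eps * eps = 1 by case: eps_pm1 => ->; rewrite ?mulrNN mulr1.
have m_gt1 : (1 < m)%N by exact: ltnW.
(* The fibre has dimension [m = n - 1], so the value [1 / (m - 1)] found for [L] is
   [1 / (n - 2)]. *)
have n2 : (m.+1%:R - 2 : R)^-1 = (m%:R - 1)^-1 by congr (_^-1); rewrite -natr1; ring.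
constructor 1; split.
  move=> p [[UQ US] UC]; rewrite n2.
  exact: (L_value m_gt1 eps2 I_open F_smooth F_gt0 N_einstein h UQ US UC).
have [[[t0 y] [[UQ US] UC]]|none] := pselect (UU !=set0); last first.
  (* When [UU] is empty the formula for [F] is vacuous and any constants will do. *)
  by exists 0, 0 => p Up; case: none; exists p.
have [It0 _] := UQ.
have W0 := U_C_fibre m_gt1 eps2 I_open F_smooth F_gt0 N_einstein UC.
have Asg := U_S_neq m_gt1 eps2 I_open F_smooth F_gt0 N_einstein US.
(* A single point of [UU] suffices: its fibre point [y] is kept, with [K = model_curv y], and the
   radial equation spreads from [t0] over all of [I]. The constants [a] and [b] thus serve all
   points of [UU] at once. *)
have rad0 := radial_eq0_everywhere I_open I_itv F_smooth F_gt0 It0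
  (fun t It H => radial_vanishes m_gt1 eps2 I_open F_smooth F_gt0 N_einstein h It W0 H)
  Asg.
have [a [b E]] := square_of_affine I_itv F_smooth F_gt0 I_neq0 rad0.
by exists a, b => p [[[Ip _] _] _]; exact: E.
Qed.
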